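(* Let $\mathbb{K}$ be a field, $(R,\mathfrak{m})$ a parameter $\mathbb{K}$-algebra, $C$ a commutative $\mathbb{K}$-algebra, and $A$ a Poisson (resp. associative) $R$-deformation of $C$. Suppose $\tau:C\to C'$ is a principal localization. Then: (1) There exists a Poisson (resp. associative) $R$-deformation $A'$ of $C'$, together with a homomorphism $g:A\to A'$ of Poisson (resp. associative) $R$-algebras which lifts $\tau$. (2) Suppose $\tau':C'\to C''$ is a homomorphism of commutative $\mathbb{K}$-algebras, $A''$ is a Poisson (resp. associative) $R$-deformation of $C''$, and $h:A\to A''$ is a homomorphism of Poisson (resp. associative) $R$-algebras which lifts $\tau'\circ\tau:C\to C''$. Then there is a unique homomorphism of Poisson (resp. associative) $R$-algebras $g':A'\to A''$ such that $h=g'\circ g$.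
   Context: A parameter $\mathbb{K}$-algebra is a complete local noetherian commutative $\mathbb{K}$-algebra $R$ with maximal ideal $\mathfrak{m}$ and $R/\mathfrak{m}=\mathbb{K}$; $R_i:=R/\mathfrak{m}^{i+1}$. An $R$-module $M$ is $\mathfrak{m}$-adically complete if $M\to\varprojlim_iR_i\otimes_RM$ is bijective. An associative $R$-deformation of a commutative $\mathbb{K}$-algebra $C$ is a flat $\mathfrak{m}$-adically complete associative unital $R$-algebra $A$ with a $\mathbb{K}$-algebra isomorphism $\mathbb{K}\otimes_RA\to C$ (augmentation). A Poisson $R$-deformation of $C$ is a flat $\mathfrak{m}$-adically complete commutative $R$-algebra with an $R$-bilinear Poisson bracket, with a Poisson isomorphism $\mathbb{K}\otimes_RA\to C$, $C$ having the zero bracket. A homomorphism $\tau:C\to C'$ is a principal localization if there is a $C$-algebra isomorphism $C'\cong C[s^{-1}]$ for some $s\in C$. A homomorphism $g:A\to A'$ between deformations of $C$ and $C'$ lifts $\tau$ if it is compatible with $\tau$ via the augmentations $A\to C$, $A'\to C'$. Algebra homomorphisms preserve units. *)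

(* Defs.v *)
From mathcomp Require Import all_boot all_order all_algebra.
Set Implicit Arguments. Unset Strict Implicit. Unset Printing Implicit Defensive.
Import GRing.Theory.
Local Open Scope ring_scope.

(* Rings may be zero rings (pz), since localizations / deformations may vanish. *)

Definition ring_hom (A B : pzRingType) (f : A -> B) : Prop :=
  f 1 = 1 /\ (forall x y, f (x + y) = f x + f y) /\ (forall x y, f (x * y) = f x * f y).

Definition alg_struct (R : comPzRingType) (A : pzRingType) (iota : R -> A) : Prop :=
  ring_hom iota /\ (forall r a, iota r * a = a * iota r).

Definition alg_hom (R : comPzRingType) (A B : pzRingType)
  (iA : R -> A) (iB : R -> B) (f : A -> B) : Prop :=
  ring_hom f /\ (forall r a, f (iA r * a) = iB r * f a).

Definition ideal (R : comPzRingType) (I : R -> Prop) : Prop :=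
  I 0 /\ (forall x y, I x -> I y -> I (x + y)) /\ (forall r x, I x -> I (r * x)).

Definition maximal_ideal (R : comPzRingType) (I : R -> Prop) : Prop :=
  ideal I /\ ~ I 1 /\
  (forall J : R -> Prop, ideal J -> (forall x, I x -> J x) -> ~ J 1 -> forall x, J x -> I x).

Definition local_ring (R : comPzRingType) (m : R -> Prop) : Prop :=
  maximal_ideal m /\ (forall J : R -> Prop, maximal_ideal J -> forall x, J x <-> m x).

Definition noetherian (R : comPzRingType) : Prop :=
  forall I : R -> Prop, ideal I ->
    exists n (g : 'I_n -> R), forall x, I x <-> exists c : 'I_n -> R, x = \sum_(i < n) c i * g i.

Definition idl_mod (R : comPzRingType) (M : zmodType) (act : R -> M -> M)
  (I : R -> Prop) (x : M) : Prop :=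
  exists n (r : 'I_n -> R) (y : 'I_n -> M),
    (forall i, I (r i)) /\ x = \sum_(i < n) act (r i) (y i).

Fixpoint ideal_pow (R : comPzRingType) (I : R -> Prop) (k : nat) : R -> Prop :=
  match k with
  | 0 => fun _ => True
  | k'.+1 => fun x => exists n (r : 'I_n -> R) (y : 'I_n -> R),
      (forall i, I (r i)) /\ (forall i, ideal_pow I k' (y i)) /\ x = \sum_(i < n) r i * y i
  end.

(* M -> lim_i R_i (x)_R M = lim_i M / m^(i+1) M is bijective
   (injective: intersection of the m^(i+1)M is 0; surjective: every compatible
   family has a preimage). *)
Definition madic_complete (R : comPzRingType) (M : zmodType) (act : R -> M -> M)
  (m : R -> Prop) : Prop :=
  (forall x : M, (forall i, idl_mod act (ideal_pow m i.+1) x) -> x = 0) /\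
  (forall xs : nat -> M, (forall i, idl_mod act (ideal_pow m i.+1) (xs i.+1 - xs i)) ->
     exists x : M, forall i, idl_mod act (ideal_pow m i.+1) (x - xs i)).

(* flatness, via the equational criterion (no tensor products available) *)
Definition flat (R : comPzRingType) (M : zmodType) (act : R -> M -> M) : Prop :=
  forall n (r : 'I_n -> R) (x : 'I_n -> M), \sum_(i < n) act (r i) (x i) = 0 ->
    exists p (a : 'I_n -> 'I_p -> R) (y : 'I_p -> M),
      (forall i, x i = \sum_(j < p) act (a i j) (y j)) /\
      (forall j, \sum_(i < n) r i * a i j = 0).

Definition parameter_algebra (K : fieldType) (R : comPzRingType) (kR : K -> R)
  (m : R -> Prop) : Prop :=
  alg_struct kR /\ local_ring m /\ noetherian R /\
  (* K -> R -> R/m is bijective *)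
  (forall r, exists c : K, m (r - kR c)) /\ (forall c : K, m (kR c) -> c = 0) /\
  madic_complete (fun a b : R => a * b) m.

Definition Kalg_hom (K : fieldType) (C C' : pzRingType) (kC : K -> C) (kC' : K -> C')
  (f : C -> C') : Prop :=
  ring_hom f /\ (forall c, f (kC c) = kC' c).

(* tau : C -> C' is a principal localization: C' is (as a C-algebra) C[s^-1]
   for some s, expressed through the standard characterization of C -> C[s^-1]. *)
Definition principal_localization (C C' : comPzRingType) (tau : C -> C') : Prop :=
  exists s : C,
    (exists u : C', tau s * u = 1) /\
    (forall y : C', exists (c : C) (n : nat), y * tau s ^+ n = tau c) /\
    (forall c : C, tau c = 0 -> exists n : nat, s ^+ n * c = 0).

(* augmentation pi : A -> C inducing a K-algebra isomorphism A/mA = K (x)_R A -> C *)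
Definition augmentation (K : fieldType) (R : comPzRingType) (kR : K -> R) (m : R -> Prop)
  (C : comPzRingType) (kC : K -> C) (A : pzRingType) (iota : R -> A) (pi : A -> C) : Prop :=
  ring_hom pi /\ (forall c : K, pi (iota (kR c)) = kC c) /\
  (forall y : C, exists a : A, pi a = y) /\
  (forall a : A, pi a = 0 <-> idl_mod (fun r x => iota r * x) m a).

Definition assoc_deformation (K : fieldType) (R : comPzRingType) (kR : K -> R)
  (m : R -> Prop) (C : comPzRingType) (kC : K -> C)
  (A : pzRingType) (iota : R -> A) (pi : A -> C) : Prop :=
  alg_struct iota /\ flat (fun r (x : A) => iota r * x) /\
  madic_complete (fun r (x : A) => iota r * x) m /\
  augmentation kR m kC iota pi.

Definition poisson_bracket (R : comPzRingType) (A : comPzRingType) (iota : R -> A)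
  (br : A -> A -> A) : Prop :=
  (forall x y z, br (x + y) z = br x z + br y z) /\
  (forall x y z, br x (y + z) = br x y + br x z) /\
  (forall r x y, br (iota r * x) y = iota r * br x y) /\
  (forall r x y, br x (iota r * y) = iota r * br x y) /\
  (forall x, br x x = 0) /\
  (forall x y z, br x (br y z) + br y (br z x) + br z (br x y) = 0) /\
  (forall x y z, br x (y * z) = br x y * z + y * br x z).

(* Poisson R-deformation of C (C carrying the zero bracket) *)
Definition poisson_deformation (K : fieldType) (R : comPzRingType) (kR : K -> R)
  (m : R -> Prop) (C : comPzRingType) (kC : K -> C)
  (A : comPzRingType) (iota : R -> A) (br : A -> A -> A) (pi : A -> C) : Prop :=
  alg_struct iota /\ poisson_bracket iota br /\ flat (fun r (x : A) => iota r * x) /\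
  madic_complete (fun r (x : A) => iota r * x) m /\
  augmentation kR m kC iota pi /\
  (forall x y, pi (br x y) = 0).

Definition poisson_hom (R : comPzRingType) (A B : comPzRingType)
  (iA : R -> A) (iB : R -> B) (brA : A -> A -> A) (brB : B -> B -> B) (f : A -> B) : Prop :=
  alg_hom iA iB f /\ (forall x y, f (brA x y) = brB (f x) (f y)).

Definition lifts (A A' C C' : Type) (pi : A -> C) (pi' : A' -> C') (tau : C -> C')
  (g : A -> A') : Prop :=
  forall a, pi' (g a) = tau (pi a).

(* Main.v *)
(** Let [s] in [A] lift the localizing element of [C], and let [F_l] be the [m]-adic
    filtration. Commutators with [s] raise [F_l] by one, because [C] is commutative.
    Sequences [u] in [A] with [u_(k+1) - u_k s -> 0], modulo null sequences, stand for
    the limits of [u_k s^-k]; they form a complete left [A]-module [M] whose filtration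
    can be computed termwise. Left multiplication by [s] on [M] is right multiplication
    by [s] composed with [1 + T] where [T] raises the filtration, so it is bijective by
    a Neumann series. Then [M] with its point [1] is initial among complete left
    [A]-modules on which [s] is bijective with a marked point, and this one universal
    property yields everything: the product ([x * y] is the image of [x] under the
    endomorphism [1 |-> y]), the ring axioms, the augmentation, part (2), and the
    extension of derivations of [A], hence of the Poisson bracket, to [M].

    Flatness of [M] is checked on sequences with the equational criterion. Solutions of
    linear equations must be chosen to converge, which is possible by a weak Artin-Rees
    lemma over the noetherian ring [R]. *)

Require Import Defs.
From HB Require Import structures.
From mathcomp Require Import all_boot all_order all_algebra ring.
From mathcomp Require Import boolp functions.
Set Implicit Arguments. Unset Strict Implicit. Unset Printing Implicit Defensive.
Import GRing.Theory.
Local Open Scope ring_scope.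

(** * Noetherian modules and a weak Artin-Rees lemma *)

(** Right multiplication by [s] commutes with the left action of [A], so the direct limit of
    [A -> A -> ...] along it is a left [A]-module without any Ore condition; steady sequences model
    its completion. The price is that no product is visible on [M], which is why multiplication has
    to come from a universal property.

    Existence and uniqueness have different sources: maps out of the localization are built as
    limits, while two of them agree because the elements [a s^-k] are dense. Hence an identity that
    is [A]-linear, or a derivation in each variable, need only be checked at 1 or on the image of
    [A]: associativity, the Jacobi identity, compatibility of brackets with the augmentation and
    with [g']. The one identity outside this pattern is [br' x x = 0], which is quadratic and does
    not follow from antisymmetry in characteristic 2.

    The algebra [C'] is killed by [m], hence complete, so the augmentation of [A'] and the map [g']
    of part (2) come from the same extension principle. *)

Definition add_closed (P : zmodType) (S : P -> Prop) : Prop :=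
  S 0 /\ (forall x y, S x -> S y -> S (x + y)).

Definition additive_map (P Q : zmodType) (f : P -> Q) : Prop :=
  forall x y, f (x + y) = f x + f y.

Section AdditiveMaps.
Variables (P Q : zmodType) (f : P -> Q).
Hypothesis fD : additive_map f.

Lemma additive_map0 : f 0 = 0.
Proof. by apply: (addrI (f 0)); rewrite -fD !addr0. Qed.

Lemma additive_mapN x : f (- x) = - f x.
Proof. by apply: (addrI (f x)); rewrite -fD !subrr additive_map0. Qed.

Lemma additive_mapB x y : f (x - y) = f x - f y.
Proof. by rewrite fD additive_mapN. Qed.

Lemma additive_map_sum (I : finType) (F : I -> P) :
  f (\sum_i F i) = \sum_i f (F i).
Proof. exact: (big_morph f fD additive_map0). Qed.

End AdditiveMaps.

Section Span.
Variables (P : zmodType) (X : P -> Prop).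

(** Only additive: the generating sets used below, such as products [r * y] with [r] in an ideal,
    are already stable under scalars. One induction principle then serves ideal powers, filtrations
    and products [I Z]. *)
Definition span (x : P) : Prop :=
  exists n (y : 'I_n -> P), (forall i, X (y i)) /\ x = \sum_(i < n) y i.

Lemma span_add_closed : add_closed span.
Proof.
split; first by exists 0, (fun=> 0); split; [case | rewrite big_ord0].
move=> x y [n1 [y1 [X1 ->]]] [n2 [y2 [X2 ->]]].
exists (n1 + n2)%N, (fun i => match fintype.split i with inl a => y1 a | inr b => y2 b end).
split; first by move=> i; case: fintype.split.
rewrite big_split_ord; congr (_ + _); apply: eq_bigr => i _.
  by rewrite (unsplitK (inl _ i)).
by rewrite (unsplitK (inr _ i)).
Qed.

Lemma span0 : span 0.
Proof. by case: span_add_closed. Qed.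

Lemma spanD x y : span x -> span y -> span (x + y).
Proof. by case: span_add_closed => _; apply. Qed.

Lemma mem_span x : X x -> span x.
Proof. by move=> Xx; exists 1, (fun=> x); rewrite big_ord1. Qed.

Lemma span_ind (S : P -> Prop) :
  add_closed S -> (forall x, X x -> S x) -> forall x, span x -> S x.
Proof.
by move=> [S0 SD] XS x [n [y [Xy ->]]]; apply: big_ind => // i _; apply: XS.
Qed.

End Span.

Lemma idl_mod_span (R : comPzRingType) (M : zmodType) (act : R -> M -> M) I x :
  idl_mod act I x <-> span (fun z => exists r y, I r /\ z = act r y) x.
Proof.
split=> [[n [r [y [Ir ->]]]]|[n [z [/choice [r /choice [y zE]] ->]]]].
  by exists n, (fun i => act (r i) (y i)); split=> // i; exists (r i), (y i).
exists n, r, y; split=> [i|]; first by case: (zE i).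
by apply: eq_bigr => i _; case: (zE i).
Qed.

Section IdealPowers.
Variables (R : comPzRingType) (I : R -> Prop).
Hypothesis idI : ideal I.

Lemma ideal_powS_span k x : ideal_pow I k.+1 x <->
  span (fun z => exists r y, [/\ I r, ideal_pow I k y & z = r * y]) x.
Proof.
split=> [[n [r [y [Ir [Iy ->]]]]]|[n [z [/choice [r /choice [y zE]] ->]]]].
  exists n, (fun i => r i * y i); split=> [i|//]; exists (r i), (y i).
  by split; [exact: Ir | exact: Iy |].
exists n, r, y; split=> [i|]; first by case: (zE i).
split=> [i|]; first by case: (zE i).
by apply: eq_bigr => i _; case: (zE i).
Qed.

Lemma ideal_pow_add_closed k : add_closed (ideal_pow I k).
Proof.
case: k => [|k] //; split; first exact/ideal_powS_span/span0.
by move=> x y /ideal_powS_span xS /ideal_powS_span yS; apply/ideal_powS_span/spanD.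
Qed.

Lemma ideal_pow_ideal k : ideal (ideal_pow I k).
Proof.
have [Z0 ZD] := ideal_pow_add_closed k; split=> //; split=> // r x.
case: k {Z0 ZD} => [|k] // /ideal_powS_span xS; apply/ideal_powS_span.
move: x xS; apply: span_ind; first split.
- by rewrite mulr0; apply: span0.
- by move=> a b aS bS; rewrite mulrDr; apply: spanD.
move=> _ [a [b [Ia Ib ->]]]; apply: mem_span; exists (r * a), b; split=> //.
  by case: idI => _ [_]; apply.
by rewrite mulrA.
Qed.

Lemma ideal_powSM k r x : I r -> ideal_pow I k x -> ideal_pow I k.+1 (r * x).
Proof. by move=> Ir Ix; apply/ideal_powS_span/mem_span; exists r, x. Qed.

Lemma ideal_powM i j x y :
  ideal_pow I i x -> ideal_pow I j y -> ideal_pow I (i + j) (x * y).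
Proof.
elim: i x => [|i IH] x; first by move=> _ Iy; case: (ideal_pow_ideal j) => _ [_]; apply.
move=> /ideal_powS_span xS Iy; rewrite addSn.
have [Z0 ZD] := ideal_pow_add_closed (i + j).+1.
move: x xS; apply: span_ind; first split.
- by rewrite mul0r.
- by move=> a b aS bS; rewrite mulrDl; apply: ZD.
by move=> _ [a [b [Ia Ib ->]]]; rewrite -mulrA; apply: ideal_powSM => //; apply: IH.
Qed.

Lemma ideal_pow_le i j x : (i <= j)%N -> ideal_pow I j x -> ideal_pow I i x.
Proof.
elim: i j x => [|i IH] [|j] x // ij /ideal_powS_span xS; apply/ideal_powS_span.
move: x xS; apply: span_ind; first exact: span_add_closed.
move=> _ [a [b [Ia Ib ->]]]; apply: mem_span; exists a, b; split=> //.
exact: IH Ib.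
Qed.

Lemma ideal_powD_span i j x : ideal_pow I (i + j) x ->
  span (fun z => exists p q, [/\ ideal_pow I i p, ideal_pow I j q & z = p * q]) x.
Proof.
elim: i x => [|i IH] x; first by move=> Ix; apply: mem_span; exists 1, x; rewrite mul1r.
rewrite addSn => /ideal_powS_span xS.
move: x xS; apply: span_ind ; first exact: span_add_closed.
move=> _ [a [b [Ia /IH bS ->]]].
apply: (@span_ind _ _ (fun b => span _ (a * b)) _ _ _ bS).
  split; first by rewrite mulr0; apply: span0.
  by move=> u v uS vS; rewrite mulrDr; apply: spanD.
move=> _ [p [q [Ip Iq ->]]]; apply: mem_span; exists (a * p), q.
by split=> //; [apply: ideal_powSM | rewrite mulrA].
Qed.

Lemma ideal_pow1 x : ideal_pow I 1 x <-> I x.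
Proof.
split=> [/ideal_powS_span|Ix]; last first.
  by apply/ideal_powS_span/mem_span; exists x, 1; rewrite mulr1.
case: idI => I0 [ID IM]; apply: span_ind => // _ [a [b [Ia _ ->]]].
by rewrite mulrC; apply: IM.
Qed.

End IdealPowers.

Section Submodules.
Variables (R : comPzRingType) (P : lmodType R).

Definition submod (Z : P -> Prop) : Prop :=
  add_closed Z /\ (forall r x, Z x -> Z (r *: x)).

Definition finitely_generated (Z : P -> Prop) : Prop :=
  exists n (g : 'I_n -> P), (forall i, Z (g i)) /\
    forall x, Z x -> exists c : 'I_n -> R, x = \sum_(i < n) c i *: g i.

Definition noetherian_module : Prop :=
  forall Z, submod Z -> finitely_generated Z.

Lemma submod_sum (Z : P -> Prop) (I : finType) (F : I -> P) :
  submod Z -> (forall i, Z (F i)) -> Z (\sum_i F i).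
Proof. by move=> [[Z0 ZD] _] ZF; apply: big_ind => // i _. Qed.

Lemma submodB (Z : P -> Prop) x y : submod Z -> Z x -> Z y -> Z (x - y).
Proof. by move=> [[_ ZD] Zs] Zx Zy; apply: ZD => //; rewrite -scaleN1r; apply: Zs. Qed.

(** Without a maximal member, dependent choice produces a strictly increasing chain; the finitely
    many generators of its union all lie in one stage, where the chain must stop. *)
Lemma noetherian_maximal (S : (P -> Prop) -> Prop) W0 : noetherian_module ->
  (forall W, S W -> submod W) -> S W0 ->
  exists W, S W /\ (forall W', S W' -> (forall x, W x -> W' x) -> forall x, W' x -> W x).
Proof.
move=> noeth Ssub SW0; apply: contrapT => /forallNP noMax.
have next (W : {W | S W}) :
    {W' : {W | S W} | (forall x, sval W x -> sval W' x) /\ ~ (forall x, sval W' x -> sval W x)}.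
  apply: cid; case: W => W SW /=; apply: contrapT => /forallNP none.
  apply: (noMax W); split=> // W' SW' le; apply: contrapT => nge.
  by apply: (none (exist _ W' SW')).
have [V [_ Vs]] := dependent_choice next (exist _ W0 SW0).
have Vle i j x : (i <= j)%N -> sval (V i) x -> sval (V j) x.
  move=> /subnK <-; elim: (j - i)%N => // k IH Vx; rewrite addSn.
  by case: (Vs (k + i)%N) => le _; apply/le/IH.
have subV i : submod (sval (V i)) by apply: Ssub; case: (V i).
have [|n [g [/choice [d gd] gen]]] := noeth (fun x => exists i, sval (V i) x).
  split; [split | move=> r x [i Vx]].
  - by exists 0; case: (subV 0) => [[]].
  - move=> x y [i Vx] [j Vy]; exists (maxn i j); case: (subV (maxn i j)) => [[_ VD] _].
    by apply: VD; [apply: Vle Vx; rewrite leq_maxl | apply: Vle Vy; rewrite leq_maxr].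
  - by exists i; case: (subV i) => _; apply.
pose D := (\max_i d i)%N; case: (Vs D) => _; apply=> x Vx.
have [|c ->] := gen x; first by exists D.+1.
apply: submod_sum => // i; case: (subV D) => _; apply.
by apply: Vle (gd i); apply: leq_bigmax.
Qed.

Lemma noetherian_chain (V : nat -> P -> Prop) : noetherian_module ->
  (forall i, submod (V i)) -> (forall i x, V i x -> V i.+1 x) ->
  exists j, forall x, V j.+1 x -> V j x.
Proof.
move=> noeth subV leV.
have [| |W [[j ->] Wmax]] := @noetherian_maximal (fun W => exists j, W = V j) (V 0) noeth.
- by move=> W [j ->].
- by exists 0.
by exists j; apply: Wmax; [exists j.+1 | apply: leV].
Qed.

Definition mulmod (I : R -> Prop) (Z : P -> Prop) : P -> Prop :=
  span (fun z => exists r y, [/\ I r, Z y & z = r *: y]).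

Lemma mulmod_submod (I : R -> Prop) (Z : P -> Prop) :
  ideal I -> submod (mulmod I Z).
Proof.
case=> I0 [ID IM]; split=> [|r x]; [exact: span_add_closed | move: x; apply: span_ind].
  split; first by rewrite scaler0; apply: span0.
  by move=> u v uS vS; rewrite scalerDr; apply: spanD.
move=> _ [a [y [Ia Zy ->]]]; apply: mem_span; exists (r * a), y.
by split=> //; [apply: IM | rewrite scalerA].
Qed.

Lemma mulmod_gens (I : R -> Prop) (Z : P -> Prop) n (g : 'I_n -> P) x : ideal I ->
  (forall x, Z x -> exists c : 'I_n -> R, x = \sum_(i < n) c i *: g i) ->
  mulmod I Z x -> exists c : 'I_n -> R, (forall i, I (c i)) /\ x = \sum_(i < n) c i *: g i.
Proof.
case=> I0 [ID IM] gen; move: x; apply: span_ind.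
  split; first by exists (fun=> 0); split=> //; rewrite big1 // => i _; rewrite scale0r.
  move=> _ _ [c [Ic ->]] [d [Id ->]]; exists (fun i => c i + d i).
  split=> [i|]; first exact: ID.
  by rewrite -big_split; apply: eq_bigr => i _; rewrite scalerDl.
move=> _ [r [y [Ir /gen [c ->] ->]]]; exists (fun i => c i * r).
split=> [i|]; first exact: IM.
by rewrite scaler_sumr; apply: eq_bigr => i _; rewrite scalerA mulrC.
Qed.

End Submodules.

(** Generators of the kernel of [phi] on [Z] are joined with lifts of generators of the ideal
    [phi Z]. *)
Lemma noetherian_extension (R : comPzRingType) (P : lmodType R) (Z : P -> Prop)
    (phi : P -> R) : noetherian R -> submod Z -> additive_map phi ->
  (forall r x, phi (r *: x) = r * phi x) ->
  finitely_generated (fun x => Z x /\ phi x = 0) -> finitely_generated Z.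
Proof.
move=> noeth subZ phiD phiZ [p [a [Za agen]]]; have [[Z0 ZD] Zs] := subZ.
have [|q [g gE]] := noeth (fun r => exists2 x, Z x & phi x = r).
  split; first by exists 0; rewrite ?(additive_map0 phiD).
  split=> [_ _ [x Zx <-] [y Zy <-]|r _ [x Zx <-]]; last by exists (r *: x); auto.
  by exists (x + y); auto.
have /choice [b bE] : forall j, exists x, Z x /\ phi x = g j.
  move=> j; suff /gE [x] : exists c, g j = \sum_i c i * g i by exists x.
  exists (fun i => (i == j)%:R); rewrite (bigD1 j) //= eqxx mul1r big1 ?addr0 // => i.
  by move/negPf->; rewrite mul0r.
exists (q + p)%N, (fun i => match fintype.split i with inl j => b j | inr j => a j end).
split=> [i|x Zx]; first by case: fintype.split => j; [case: (bE j) | case: (Za j)].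
have /gE [c cE] : exists2 z, Z z & phi z = phi x by exists x.
pose y := x - \sum_j c j *: b j.
have [|d yE] := agen y.
  split; first by apply: submodB => //; apply: submod_sum => // j; apply: Zs; case: (bE j).
  rewrite (additive_mapB phiD) (additive_map_sum phiD) cE; apply/eqP; rewrite subr_eq0.
  by apply/eqP/eq_bigr => j _; rewrite phiZ; case: (bE j) => _ ->.
exists (fun i => match fintype.split i with inl j => c j | inr j => d j end).
have -> : x = \sum_j c j *: b j + \sum_j d j *: a j by rewrite -yE addrC subrK.
rewrite big_split_ord /=.
congr (_ + _); apply: eq_bigr => i _.
  by rewrite (unsplitK (inl _ i)).
by rewrite (unsplitK (inr _ i)).
Qed.

Lemma noetherian_rV (R : comPzRingType) n : noetherian R ->
  noetherian_module ('rV[R]_n : lmodType R).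
Proof.
move=> noeth.
(* Induction on the number [k] of coordinates that may be nonzero; the last of them serves as [phi]
   in the extension lemma. *)
suff step k (Z : 'rV[R]_n -> Prop) : submod Z ->
    (forall x, Z x -> forall i : 'I_n, (k <= i)%N -> x 0 i = 0) -> finitely_generated Z.
  by move=> Z subZ; apply: (step n) => // x _ i; rewrite leqNgt ltn_ord.
elim: k Z => [|k IH] Z subZ Zk.
  exists 0, (fun=> 0); split=> [[]|] // x Zx; exists (fun=> 0); rewrite big_ord0.
  by apply/rowP => i; rewrite mxE; apply: Zk.
have [kn|nk] := ltnP k n; last first.
  by apply: IH => // x Zx i ki; have := leq_ltn_trans (leq_trans nk ki) (ltn_ord i); rewrite ltnn.
pose phi (x : 'rV[R]_n) := x 0 (Ordinal kn).
apply: (@noetherian_extension _ _ _ phi) => //.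
- by move=> x y; rewrite /phi mxE.
- by move=> r x; rewrite /phi mxE.
apply: IH.
  have [[Z0 ZD] Zs] := subZ; split; [split | move=> r x [Zx px]].
  - by split=> //; rewrite /phi mxE.
  - by move=> x y [Zx px] [Zy py]; split; [exact: ZD | rewrite /phi mxE -!/(phi _) px py addr0].
  - by split; [exact: Zs | rewrite /phi mxE -/(phi _) px mulr0].
move=> x [Zx px] i; rewrite leq_eqVlt => /orP [/eqP ki|]; last exact: Zk.
by rewrite -px /phi; congr (x 0 _); apply: val_inj.
Qed.

(** * Nilpotence modulo an ideal, and Artin-Rees for noetherian modules *)

Section ArtinRees.
Variables (R : comPzRingType) (m : R -> Prop).
Hypotheses (noeth : noetherian R) (idm : ideal m).

(** [m^l] lies in [I + (t)], so [m^(j l)] lies in [(I + (t))^j], hence in [I + (t^j)], which is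
    [I]. *)
Lemma nilpotent_step (I : R -> Prop) t j l : ideal I -> I (t ^+ j) ->
  (forall x, ideal_pow m l x -> exists y, I (x - y * t)) ->
  forall x, ideal_pow m (j * l) x -> I x.
Proof.
move=> [I0 [ID IM]] It mt.
have IB x y : I x -> I y -> I (x - y) by move=> Ix Iy; apply: ID => //; rewrite -mulN1r; apply: IM.
have step i x : ideal_pow m (i * l) x -> exists y, I (x - y * t ^+ i).
  elim: i x => [|i IH] x; first by exists x; rewrite mulr1 subrr.
  rewrite mulSn => /(ideal_powD_span) xS; move: x xS; apply: span_ind.
    split; first by exists 0; rewrite mul0r subr0.
    move=> x1 x2 [y1 I1] [y2 I2]; exists (y1 + y2).
    by rewrite mulrDl opprD addrACA; apply: ID.
  move=> _ [p [q [/mt [y Iy] /IH [z Iz] ->]]]; exists (y * z).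
  have -> : p * q - y * z * t ^+ i.+1
      = q * (p - y * t) + (y * t) * (q - z * t ^+ i).
    rewrite !mulrBr [q * p]mulrC exprS addrA [q * _]mulrC subrK; congr (_ - _).
    by rewrite !mulrA; congr (_ * _); rewrite -!mulrA [z * t]mulrC.
  by apply: ID; apply: IM.
move=> x /step [y Iy]; rewrite -[x](subrK (y * t ^+ j)); apply: ID => //; exact: IM.
Qed.

Lemma nilpotent_ideal (J : R -> Prop) : ideal J ->
  (forall t, m t -> exists j, J (t ^+ j)) -> exists l, forall x, ideal_pow m l x -> J x.
Proof.
move=> idJ nil; have [n [g gE]] := noeth idm.
(* [J] plus the ideal of the first [k] generators of [m]. Going down from [k = n], where it contains
   [m], each step drops one generator, which is nilpotent modulo [J]. *)
pose I k x := exists c : 'I_n -> R, J (x - \sum_(i < n | (i < k)%N) c i * g i).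
have [J0 [JD JM]] := idJ.
have idI k : ideal (I k).
  split; first by exists (fun=> 0); rewrite big1 ?subr0 // => i _; rewrite mul0r.
  split=> [x y [c Jc] [d Jd]|r x [c Jc]].
    exists (fun i => c i + d i).
    rewrite (eq_bigr (fun i => c i * g i + d i * g i)); last by move=> i _; rewrite mulrDl.
    by rewrite big_split opprD addrACA; apply: JD.
  exists (fun i => r * c i).
  rewrite (eq_bigr (fun i => r * (c i * g i))); last by move=> i _; rewrite mulrA.
  by rewrite -mulr_sumr -mulrBr; apply: JM.
suff step k : (k <= n)%N -> exists l, forall x, ideal_pow m l x -> I (n - k)%N x.
  have [l lI] := step n (leqnn n); exists l => x /lI [c].
  by rewrite subnn big_pred0 ?subr0.
elim: k => [|k IH] kn.
  exists 1 => x /(ideal_pow1 idm) /gE [c ->]; exists c; rewrite subn0.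
  by rewrite [X in _ - X](eq_bigl xpredT) ?subrr // => i; rewrite ltn_ord.
have [l lI] := IH (ltnW kn); have ltk : (n - k.+1 < n)%N by rewrite ltn_subrL; case: (n) kn.
pose t := g (Ordinal ltk); have [|j Jt] := nil t.
  apply/gE; exists (fun i => (i == Ordinal ltk)%:R).
  rewrite (bigD1 (Ordinal ltk)) //= eqxx mul1r big1 ?addr0 // => i.
  by move/negPf->; rewrite mul0r.
exists (j * l)%N; apply: (@nilpotent_step _ t j l (idI _)).
  by exists (fun=> 0); rewrite big1 ?subr0 // => i _; rewrite mul0r.
move=> x /lI [c Jc]; exists (c (Ordinal ltk)), c.
move: Jc; rewrite (bigD1 (Ordinal ltk)) /=; last by rewrite -subSn.
rewrite opprD addrA; congr (J (_ - _)); apply: eq_bigl => i.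
rewrite -[(n - k)%N]/((n.+1 - k.+1)%N) subSn // ltnS [RHS]ltn_neqAle andbC.
by rewrite -val_eqE.
Qed.

Variable P : lmodType R.
Hypothesis noethP : noetherian_module P.

(* W maximal with W meeting Z in m Z contains t^j P for each t in m, where j is a
   step at which the chain (W : t^j) stabilises. *)
Lemma artin_rees1 (Z : P -> Prop) : submod Z -> exists l, forall z,
  Z z -> mulmod (ideal_pow m l) (fun=> True) z -> mulmod m Z z.
Proof.
move=> subZ; have subM := mulmod_submod Z idm.
pose S W := submod W /\ (forall z, W z -> Z z -> mulmod m Z z) /\
            (forall z, mulmod m Z z -> W z).
have [| |W [[subW [WZ ZW]] Wmax]] := @noetherian_maximal _ P S (mulmod m Z) noethP.
- by move=> W [].
- by split.
have [[W0 WD] Ws] := subW.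
pose J r := forall u, W (r *: u).
have [|t mt|l lJ] := @nilpotent_ideal J.
- split=> [u|]; first by rewrite scale0r.
  split=> [x y Jx Jy u|r x Jx u]; first by rewrite scalerDl; apply: WD.
  by rewrite -scalerA; apply: Ws.
- have [|i u|j stab] := @noetherian_chain _ P (fun j u => W (t ^+ j *: u)) noethP.
  + move=> i; split; [split | move=> r u Wu].
    * by rewrite scaler0.
    * by move=> u v Wu Wv; rewrite scalerDr; apply: WD.
    * by rewrite scalerA mulrC -scalerA; apply: Ws.
  + by move=> Wu; rewrite exprS -scalerA; apply: Ws.
  exists j => u.
  apply: (Wmax (fun x => exists v w, W w /\ x = t ^+ j *: v + w)); last 2 first.
  + by move=> x Wx; exists 0, x; rewrite scaler0 add0r.
  + by exists u, 0; rewrite addr0.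
  split; first split; first split.
  + by exists 0, 0; rewrite scaler0 addr0.
  + move=> _ _ [v [w [Ww ->]]] [v' [w' [Ww' ->]]]; exists (v + v'), (w + w').
    by split; [exact: WD | rewrite scalerDr addrACA].
  + move=> r _ [v [w [Ww ->]]]; exists (r *: v), (r *: w).
    by split; [exact: Ws | rewrite scalerDr !scalerA mulrC].
  split=> [_ [v [w [Ww ->]]] Zx|z /ZW Wz]; last by exists 0, z; rewrite scaler0 add0r.
  (* [t (t^j v + w)] lies in [m Z], hence in [W], so [t^(j+1) v] lies in [W]; stability of the chain
     at [j] drops one factor [t]. *)
  apply: WZ => //; apply: WD => //; apply: stab.
  rewrite exprS -scalerA.
  have -> : t *: (t ^+ j *: v) = t *: (t ^+ j *: v + w) - t *: w by rewrite scalerDr addrK.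
  apply: submodB => //; last exact: Ws.
  by apply/ZW/mem_span; exists t, (t ^+ j *: v + w).
exists l => z Zz lz; apply: WZ => //.
by apply: span_ind lz => // _ [r [u [/lJ Jr _ ->]]].
Qed.

(** Iteration of [artin_rees1] on the submodules [m^k Z], as [m (m^k Z)] lies in [m^(k+1) Z]. The
    growth of [l] with [k] is left uncontrolled: convergence arguments ask only for some [l]. *)
Lemma artin_rees (Z : P -> Prop) k : submod Z -> exists l, forall z,
  Z z -> mulmod (ideal_pow m l) (fun=> True) z -> mulmod (ideal_pow m k) Z z.
Proof.
move=> subZ; elim: k => [|k [l lZ]].
  by exists 0 => z Zz _; apply: mem_span; exists 1, z; rewrite scale1r.
have idk := ideal_pow_ideal idm k.
have [l' l'Z] := artin_rees1 (mulmod_submod Z idk).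
exists (maxn l l') => z Zz mz.
have mono i : (i <= maxn l l')%N -> mulmod (ideal_pow m i) (fun=> True) z.
  move=> le; apply: span_ind mz; first exact: span_add_closed.
  move=> _ [r [u [mr _ ->]]]; apply: mem_span; exists r, u; split=> //.
  exact: ideal_pow_le mr.
have := l'Z z (lZ z Zz (mono l (leq_maxl _ _))) (mono l' (leq_maxr _ _)).
apply: span_ind; first exact: span_add_closed.
move=> _ [r [y [mr yS ->]]].
have [[M0 MD] Ms] := mulmod_submod Z (ideal_pow_ideal idm k.+1).
apply: (@span_ind _ _ (fun y => mulmod _ _ (r *: y)) _ _ _ yS).
  by split=> [|u v]; rewrite ?scaler0 ?scalerDr //; apply: MD.
move=> _ [p [q [mp Zq ->]]]; apply: mem_span; exists (r * p), q.
by split=> //; [apply: ideal_powSM | rewrite scalerA].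
Qed.

End ArtinRees.

(** * Filtrations and flat modules *)

Definition module_action (B : pzRingType) (P : zmodType) (act : B -> P -> P) : Prop :=
  [/\ forall x, act 1 x = x, forall x, additive_map (act^~ x),
      forall a, additive_map (act a) & forall a b x, act (a * b) x = act a (act b x)].

Lemma act_suml (B : pzRingType) (P : zmodType) (act : B -> P -> P) (I : finType)
  (F : I -> B) x : module_action act -> act (\sum_i F i) x = \sum_i act (F i) x.
Proof. by case=> _ /(_ x) actDl _ _; apply: (additive_map_sum actDl). Qed.

Lemma act_sumr (B : pzRingType) (P : zmodType) (act : B -> P -> P) (I : finType)
  (F : I -> P) a : module_action act -> act a (\sum_i F i) = \sum_i act a (F i).
Proof. by case=> _ _ /(_ a) actDr _; apply: (additive_map_sum actDr). Qed.

Lemma act0l (B : pzRingType) (P : zmodType) (act : B -> P -> P) x :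
  module_action act -> act 0 x = 0.
Proof. by case=> _ /(_ x) actDl _ _; apply: (additive_map0 actDl). Qed.

Lemma actNl (B : pzRingType) (P : zmodType) (act : B -> P -> P) a x :
  module_action act -> act (- a) x = - act a x.
Proof. by case=> _ /(_ x) actDl _ _; apply: (additive_mapN actDl). Qed.

Section Filtration.
Variables (R : comPzRingType) (m : R -> Prop) (P : zmodType) (act : R -> P -> P).
Hypotheses (idm : ideal m) (actP : module_action act).

Definition fil (l : nat) : P -> Prop := idl_mod act (ideal_pow m l).

Let act1 x : act 1 x = x. Proof. by case: actP. Qed.
Let actDl x : additive_map (act^~ x). Proof. by case: actP. Qed.
Let actDr a : additive_map (act a). Proof. by case: actP. Qed.
Let actM a b x : act (a * b) x = act a (act b x). Proof. by case: actP. Qed.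

Lemma fil_ind l (S : P -> Prop) : add_closed S ->
  (forall r x, ideal_pow m l r -> S (act r x)) -> forall x, fil l x -> S x.
Proof.
move=> cS Sact x /idl_mod_span; move: x; apply: span_ind => // _ [r [x [mr ->]]].
exact: Sact.
Qed.

Lemma fil_act l r x : ideal_pow m l r -> fil l (act r x).
Proof. by move=> mr; apply/idl_mod_span/mem_span; exists r, x. Qed.

Lemma fil_zero l : fil l 0.
Proof. exact/idl_mod_span/span0. Qed.

Lemma filD l x y : fil l x -> fil l y -> fil l (x + y).
Proof. by move=> /idl_mod_span fx /idl_mod_span fy; apply/idl_mod_span/spanD. Qed.

Lemma fil_add_closed l : add_closed (fil l).
Proof. by split; [exact: fil_zero | exact: filD]. Qed.

Lemma fil_top x : fil 0 x.
Proof. by rewrite -[x]act1; apply: fil_act. Qed.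

Lemma filM l r x : fil l x -> fil l (act r x).
Proof.
move: x; apply: fil_ind => [|a x ma].
  split=> [|x y fx fy]; rewrite ?(additive_map0 (actDr r)) ?actDr.
    exact: fil_zero.
  exact: filD.
by rewrite -actM; apply: fil_act; case: (ideal_pow_ideal idm l) => _ [_]; apply.
Qed.

Lemma filN l x : fil l x -> fil l (- x).
Proof. by move/(filM (-1)); rewrite (actNl _ _ actP) act1. Qed.

Lemma filB l x y : fil l x -> fil l y -> fil l (x - y).
Proof. by move=> fx fy; apply/filD/filN. Qed.

Lemma fil_sum l (I : finType) (F : I -> P) :
  (forall i, fil l (F i)) -> fil l (\sum_i F i).
Proof. by move=> fF; apply: big_ind => //; [exact: fil_zero | exact: filD]. Qed.

Lemma fil_le i j x : (i <= j)%N -> fil j x -> fil i x.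
Proof.
move=> ij; move: x; apply: fil_ind => [|r x mr]; first exact: fil_add_closed.
by apply: fil_act; apply: ideal_pow_le mr.
Qed.

(** Splitting [m^(i+k)] as [m^i m^k] moves the factor from [m^k] into the coefficients. For the row
    of generators [t] this is an explicit form of the property [lifting] below, with [l = i + k]. *)
Lemma fil_gens i k n (t : 'I_n -> R) x :
  (forall r, ideal_pow m i r <-> exists c : 'I_n -> R, r = \sum_(j < n) c j * t j) ->
  fil (i + k) x ->
  exists c : 'I_n -> P, (forall j, fil k (c j)) /\ x = \sum_j act (t j) (c j).
Proof.
move=> tE; pose S x := exists c : 'I_n -> P,
  (forall j, fil k (c j)) /\ x = \sum_j act (t j) (c j).
have cS : add_closed S.
  split.
    exists (fun=> 0); split=> [j|]; first exact: fil_zero.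
    by rewrite big1 // => j _; rewrite (additive_map0 (actDr _)).
  move=> _ _ [c [fc ->]] [d [fd ->]]; exists (fun j => c j + d j).
  split=> [j|]; first exact: filD.
  by rewrite -big_split; apply: eq_bigr => j _; rewrite actDr.
move: x; apply: fil_ind => // r x /ideal_powD_span rS.
apply: (@span_ind _ _ (fun r => S (act r x)) _ _ _ rS).
  split=> [|a b aS bS]; first by rewrite (act0l _ actP); case: cS.
  by rewrite actDl; case: cS => _; apply.
move=> _ [p [q [/tE [c ->] mq ->]]]; exists (fun j => act (c j * q) x).
split=> [j|]; first by rewrite actM; apply/filM/fil_act.
rewrite mulr_suml (act_suml _ _ actP); apply: eq_bigr => j _.
by rewrite -actM mulrA [t j * c j]mulrC.
Qed.

Definition null (u : nat -> P) : Prop :=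
  forall l, exists n, forall k, (n <= k)%N -> fil l (u k).

Lemma null_eventually n (u v : nat -> P) :
  (forall k, (n <= k)%N -> u k = v k) -> null u -> null v.
Proof.
move=> uv nu l; have [n' nl] := nu l; exists (maxn n n') => k.
by rewrite geq_max => /andP [nk n'k]; rewrite -uv //; apply: nl.
Qed.

Lemma null_ext (u v : nat -> P) : u =1 v -> null u -> null v.
Proof. by move=> uv; apply: (@null_eventually 0) => k _. Qed.

Lemma nullD u v : null u -> null v -> null (fun k => u k + v k).
Proof.
move=> nu nv l; have [n nl] := nu l; have [n' nl'] := nv l; exists (maxn n n') => k.
by rewrite geq_max => /andP [nk n'k]; apply: filD; [apply: nl | apply: nl'].
Qed.

Lemma nullN u : null u -> null (fun k => - u k).
Proof. by move=> nu l; have [n nl] := nu l; exists n => k /nl; apply: filN. Qed.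

Lemma nullB u v : null u -> null v -> null (fun k => u k - v k).
Proof. by move=> nu nv; apply/nullD/nullN. Qed.

Lemma null0 : null (fun=> 0).
Proof. by move=> l; exists 0 => k _; apply: fil_zero. Qed.

Lemma null_sum (I : finType) (F : I -> nat -> P) :
  (forall i, null (F i)) -> null (fun k => \sum_i F i k).
Proof.
move=> nF l; have /choice [n nl] : forall i, exists n, forall k, (n <= k)%N -> fil l (F i k).
  by move=> i; apply: nF.
exists (\max_i n i)%N => k le; apply: fil_sum => i; apply: nl.
by apply: leq_trans le; apply: leq_bigmax.
Qed.

Lemma null_shift u : null u -> null (fun k => u k.+1).
Proof. by move=> nu l; have [n nl] := nu l; exists n => k nk; apply/nl/leqW. Qed.

Lemma null_map (f : P -> P) u : (forall l x, fil l x -> fil l (f x)) ->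
  null u -> null (fun k => f (u k)).
Proof. by move=> ff nu l; have [n nl] := nu l; exists n => k /nl; apply: ff. Qed.

Lemma fil_telescope l n u : (forall k, (n <= k)%N -> fil l (u k.+1 - u k)) ->
  forall j k, (n <= k)%N -> (k <= j)%N -> fil l (u j - u k).
Proof.
move=> nl j k nk /subnK <-; elim: (j - k)%N => [|i IH]; first by rewrite subrr; apply: fil_zero.
rewrite addSn -(subrK (u (i + k)%N) (u (i + k).+1)) -addrA; apply: filD => //.
by apply: nl; apply: leq_trans nk (leq_addl _ _).
Qed.

Hypothesis compl : madic_complete act m.

Lemma fil_separated x : (forall l, fil l x) -> x = 0.
Proof. by move=> fx; case: compl => sep _; apply: sep => i; apply: fx. Qed.

Lemma null_cst x : null (fun=> x) -> x = 0.
Proof. by move=> nx; apply: fil_separated => l; have [n nl] := nx l; apply: (nl n). Qed.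

Lemma cauchy_converges u : null (fun k => u k.+1 - u k) -> exists x, null (fun k => u k - x).
Proof.
(* [madic_complete] prescribes the rate [m^(i+1)] between consecutive terms, so a subsequence is
   taken. The range [i.+2] makes [N i] dominate the thresholds of all levels up to [i + 1]. *)
move=> /choice [n nl]; pose N i := \max_(j < i.+2) n j.
have leN l i : (l <= i.+1)%N -> (n l <= N i)%N.
  by rewrite -ltnS => li; apply: (leq_bigmax (Ordinal li)).
have NS i : (N i <= N i.+1)%N by rewrite {2}/N big_ord_recr /= leq_maxl.
have [_ /(_ (fun i => u (N i)))] := compl; case=> [i|x xN].
  by apply: (fil_telescope (nl i.+1)) => //; apply: leN.
exists x => l; exists (N l) => k Nk; apply: (@fil_le l l.+1) => //.
rewrite -(subrK (u (N l)) (u k)) -addrA; apply: filD.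
  by apply: (fil_telescope (nl l.+1)) => //; apply: leN.
by rewrite -opprB; apply: filN; apply: xN.
Qed.

Lemma neumann (T : P -> P) : additive_map T ->
  (forall l x, fil l x -> fil l.+1 (T x)) ->
  (forall y, exists x, x + T x = y) /\ (forall x, x + T x = 0 -> x = 0).
Proof.
move=> TD Tf; split=> [y|x xT]; last first.
  apply: fil_separated; elim=> [|l IH]; first exact: fil_top.
  by rewrite -[x](addrK (T x)) xT sub0r; apply/filN/Tf.
(* Fixed-point iteration for [x = y - T x]; consecutive terms differ by plus or minus
   [T^(k+1) y]. *)
pose u k := iter k (fun z => y - T z) y.
have uf k : fil k (u k.+1 - u k).
  elim: k => [|k IH]; first exact: fil_top.
  have -> : u k.+2 - u k.+1 = - T (u k.+1 - u k).
    by rewrite (additive_mapB TD) /= opprB [y - T _]addrC opprD addrACA addrN addr0 opprK addrC.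
  exact/filN/Tf.
have [|x xu] := @cauchy_converges u.
  by move=> l; exists l => k lk; apply: fil_le (uf k).
exists x; apply/eqP; rewrite -subr_eq0; apply/eqP/fil_separated => l.
have [n nl] := xu l.
have -> : x + T x - y = - (u n.+1 - x) - T (u n - x).
  rewrite (additive_mapB TD) /= !opprB -!addrA; congr (x + _).
  by rewrite addrCA [T (u n) + _]addrC subrK addrC.
apply: filB; first by apply/filN/nl; rewrite leqnSn.
by apply/(@fil_le l l.+1) => //; apply/Tf/nl.
Qed.

End Filtration.

(** * Flat modules: systems of equations and small coefficients *)

Section FlatModules.
Variables (R : comPzRingType) (M : zmodType) (act : R -> M -> M).
Hypotheses (actP : module_action act) (flatM : flat act).

Let actDl x : additive_map (act^~ x). Proof. by case: actP. Qed.
Let actDr a : additive_map (act a). Proof. by case: actP. Qed.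
Let actM a b x : act (a * b) x = act a (act b x). Proof. by case: actP. Qed.

Lemma flat_fin (T : finType) (r : T -> R) (x : T -> M) :
  \sum_t act (r t) (x t) = 0 ->
  exists p (a : T -> 'I_p -> R) (y : 'I_p -> M),
    (forall t, x t = \sum_j act (a t j) (y j)) /\ (forall j, \sum_t r t * a t j = 0).
Proof.
rewrite (reindex _ (onW_bij _ (@enum_val_bij T))) /= => rel.
have [p [a [y [xE aE]]]] := flatM rel.
exists p, (fun t => a (enum_rank t)), y; split=> [t|j]; first by rewrite -xE enum_rankK.
rewrite (reindex _ (onW_bij _ (@enum_val_bij T))) /= -[RHS](aE j).
by apply: eq_bigr => i _; rewrite enum_valK.
Qed.

(** Equations are solved one at a time: once the first [e] are solved, the last one becomes a single
    relation among the new elements [y], and the two coefficient matrices are multiplied. *)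
Lemma flat_system (T : finType) e (r : nat -> T -> R) (x : T -> M) :
  (forall i, (i < e)%N -> \sum_t act (r i t) (x t) = 0) ->
  exists p (a : T -> 'I_p -> R) (y : 'I_p -> M),
    (forall t, x t = \sum_j act (a t j) (y j)) /\
    (forall i, (i < e)%N -> forall j, \sum_t r i t * a t j = 0).
Proof.
elim: e => [|e IH] rel.
  have [|p [a [y [xE _]]]] := @flat_fin T (fun=> 0) x; last by exists p, a, y.
  by rewrite big1 // => t _; rewrite (act0l _ actP).
have [i ie|p [a [y [xE aE]]]] := IH; first by apply: rel; apply: ltnW.
have [|q [b [w [yE bE]]]] := @flat_fin _ (fun j => \sum_t r e t * a t j) y.
  rewrite -[RHS](rel e (leqnn _)); under eq_bigr do rewrite (act_suml _ _ actP).
  rewrite exchange_big; apply: eq_bigr => t _; rewrite xE (act_sumr _ _ actP).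
  by apply: eq_bigr => j _; rewrite actM.
exists q, (fun t h => \sum_j a t j * b j h), w; split=> [t|i ie h].
  rewrite xE; under eq_bigr do rewrite yE (act_sumr _ _ actP).
  rewrite exchange_big; apply: eq_bigr => h _; rewrite (act_suml _ _ actP).
  by apply: eq_bigr => j _; rewrite actM.
have -> : \sum_t r i t * (\sum_j a t j * b j h) = \sum_j (\sum_t r i t * a t j) * b j h.
  under eq_bigr do rewrite mulr_sumr.
  rewrite exchange_big; apply: eq_bigr => j _; rewrite mulr_suml.
  by apply: eq_bigr => t _; rewrite mulrA.
move: ie; rewrite ltnS leq_eqVlt => /orP [/eqP ->|ie]; first exact: bE.
by rewrite big1 // => j _; rewrite aE // mul0r.
Qed.

Variable m : R -> Prop.
Hypotheses (noeth : noetherian R) (idm : ideal m).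

Definition combination p n (a : 'I_p -> 'I_n -> R) (u : 'I_n -> M) (y : 'I_p -> M) : Prop :=
  forall i, u i = \sum_j act (a j i) (y j).

(** Topologically, the map [M^p -> M^n] with matrix [a] is open onto its image for the adic
    topologies. *)
Definition lifting p n (a : 'I_p -> 'I_n -> R) : Prop :=
  forall k, exists l, forall u : 'I_n -> M, (forall i, fil m act l (u i)) ->
    (exists y, combination a u y) ->
    exists c, (forall j, fil m act k (c j)) /\ combination a u c.

(** Artin-Rees is applied in [R^n] and carried to [M] by flatness. Writing [u] through generators
    [t] of [m^l] turns [u = sum a y] into a linear system over [R], whose solution in [M] comes from
    solutions [b] over [R]. The [y]-part of [b] gives vectors of [Z] lying in [m^l R^n], and these
    can be rewritten with coefficients in [m^k]. *)
Lemma flat_artin_rees p n (a : 'I_p -> 'I_n -> R) : lifting a.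
Proof.
move=> k; pose row j : 'rV[R]_n := \row_i a j i.
pose Z (z : 'rV[R]_n) := exists c : 'I_p -> R, z = \sum_j c j *: row j.
have subZ : submod Z.
  split; [split | move=> r _ [c ->]].
  - by exists (fun=> 0); rewrite big1 // => j _; rewrite scale0r.
  - move=> _ _ [c ->] [d ->]; exists (fun j => c j + d j); rewrite -big_split.
    by apply: eq_bigr => j _; rewrite scalerDl.
  - exists (fun j => r * c j); rewrite scaler_sumr.
    by apply: eq_bigr => j _; rewrite scalerA.
have [l lZ] := artin_rees noeth idm (@noetherian_rV R n noeth) k subZ.
exists l => u fu [y uE].
have [q [t tE]] := noeth (ideal_pow_ideal idm l).
have /choice [v vE] : forall i, exists v : 'I_q -> M, u i = \sum_h act (t h) (v h).
  move=> i; have [|v [_ ->]] := @fil_gens _ m _ act idm actP l 0 _ t (u i) tE.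
    by rewrite addn0.
  by exists v.
(* The unknowns are the [y_j] and the coefficients [v_ih] of [u_i]; equation [i] says
   [sum_j a_ji y_j = sum_h t_h v_ih]. As equations are numbered by naturals, [insub] recovers the
   index of the row. *)
pose T : finType := ('I_p + 'I_n * 'I_q)%type.
pose x (s : T) := match s with inl j => y j | inr ih => v ih.1 ih.2 end.
pose r i (s : T) := match s with
  | inl j => if insub i is Some i' then a j i' else 0
  | inr ih => if ih.1 == i :> nat then - t ih.2 else 0 end.
have rE (N : zmodType) (i : 'I_n) (F : R -> T -> N) : (forall s, F 0 s = 0) ->
    \sum_s F (r i s) s = \sum_j F (a j i) (inl j) + \sum_h F (- t h) (inr (i, h)).
  move=> F0; rewrite big_sumType /= valK; congr (_ + _).
  transitivity (\sum_i' \sum_h F (r i (inr (i', h))) (inr (i', h))).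
    by rewrite pair_big; apply: eq_bigr => [[]].
  rewrite (bigD1 i) //= [X in _ + X]big1 ?addr0 => [|i' /negPf ne].
    by apply: eq_bigr => h _; rewrite eqxx.
  by rewrite big1 // => h _; rewrite val_eqE ne F0.
have [i i_n|P [b [w [xE bE]]]] := @flat_system T n r x.
  rewrite (rE _ (Ordinal i_n) (fun c s => act c (x s))) => [|s]; last first.
    by rewrite (act0l _ actP).
  rewrite -uE vE -big_split big1 // => h _ /=.
  by rewrite (actNl _ _ actP) subrr.
have zE h i : \sum_j a j i * b (inl j) h = \sum_g t g * b (inr (i, g)) h.
  have := bE i (ltn_ord i) h; rewrite (rE _ i (fun c s => c * b s h)) => [|s]; last first.
    by rewrite mul0r.
  move/eqP; rewrite addr_eq0 => /eqP ->; rewrite -sumrN.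
  by apply: eq_bigr => g _; rewrite mulNr opprK.
have /choice [c cE] : forall h, exists c : 'I_p -> R, (forall j, ideal_pow m k (c j)) /\
    \sum_j b (inl j) h *: row j = \sum_j c j *: row j.
  move=> h; pose z := \sum_j b (inl j) h *: row j.
  have Zz : Z z by exists (fun j => b (inl j) h).
  suff zl : mulmod (ideal_pow m l) (fun=> True) z.
    exact: (mulmod_gens (ideal_pow_ideal idm k) (fun x Zx => Zx) (lZ z Zz zl)).
  rewrite [z]row_sum_delta; apply: big_ind => [||i _]; [exact: span0 | exact: spanD |].
  apply: mem_span; exists (z 0 i), (delta_mx 0 i); split=> //.
  rewrite summxE; under eq_bigr do rewrite !mxE mulrC.
  rewrite zE; apply/tE; exists (fun g => b (inr (i, g)) h).
  by apply: eq_bigr => g _; rewrite mulrC.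
exists (fun j => \sum_h act (c h j) (w h)); split=> [j|i].
  by apply: fil_sum => h; apply: fil_act; case: (cE h).
rewrite uE; transitivity (\sum_h act ((\sum_j b (inl j) h *: row j) 0 i) (w h)).
  under eq_bigr => j _ do rewrite -[y j]/(x (inl j)) xE (act_sumr _ _ actP).
  rewrite exchange_big; apply: eq_bigr => h _.
  rewrite summxE (act_suml _ _ actP); apply: eq_bigr => j _.
  by rewrite !mxE mulrC actM.
under [RHS]eq_bigr => j _ do rewrite (act_sumr _ _ actP).
rewrite exchange_big; apply: eq_bigr => h _; case: (cE h) => _ ->.
rewrite summxE (act_suml _ _ actP); apply: eq_bigr => j _.
by rewrite !mxE mulrC actM.
Qed.

End FlatModules.

(** A given [u k] may have no best [y], since arbitrarily deep levels can be available. So the level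
    sought at [k] is capped at [k]; level [l] is still reached once [k] passes both [l] and the
    threshold of [u] for [l']. *)
Lemma decay_choice (X Y : Type) (S : X -> Y -> Prop) (U : nat -> X -> Prop)
    (V : nat -> Y -> Prop) (u : nat -> X) :
  (forall i j y, (i <= j)%N -> V j y -> V i y) ->
  (forall k, exists y, S (u k) y /\ V 0 y) ->
  (forall l, exists l', forall k, U l' (u k) -> exists y, S (u k) y /\ V l y) ->
  (forall l, exists n, forall k, (n <= k)%N -> U l (u k)) ->
  exists y, (forall k, S (u k) (y k)) /\ forall l, exists n, forall k, (n <= k)%N -> V l (y k).
Proof.
move=> Vle ex0 lift null_u.
have step k : exists y, S (u k) y /\
    forall l, (l <= k)%N -> (exists y, S (u k) y /\ V l y) -> V l y.
  suff step K : exists y, S (u k) y /\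
      forall l, (l <= K)%N -> (exists y, S (u k) y /\ V l y) -> V l y by exact: (step k).
  elim: K => [|K [y [Sy yV]]].
    by have [y [Sy Vy]] := ex0 k; exists y; split=> // l; rewrite leqn0 => /eqP ->.
  have [[y' [Sy' Vy']]|none] := pselect (exists y, S (u k) y /\ V K.+1 y).
    by exists y'; split=> // l lK _; apply: Vle Vy'.
  exists y; split=> // l; rewrite leq_eqVlt => /orP [/eqP -> //|lK]; exact: yV.
have [y yP] := choice step; exists y; split=> [k|l]; first by case: (yP k).
have [l' l'P] := lift l; have [n nU] := null_u l'.
exists (maxn n l) => k; rewrite geq_max => /andP [nk lk].
by case: (yP k) => _; apply=> //; apply/l'P/nU.
Qed.

(** * The completed localization as a module *)

(** [M] is [N / N0], realized by canonical representatives of cosets. Only [cl], [rep] and their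
    relations are passed on, and the study of the localized module rests on these alone. *)
Lemma subquotient (V : zmodType) (N N0 : V -> Prop) :
  N 0 -> (forall u v, N u -> N v -> N (u - v)) ->
  N0 0 -> (forall u v, N0 u -> N0 v -> N0 (u - v)) -> (forall u, N0 u -> N u) ->
  exists (M : zmodType) (cl : V -> M) (rep : M -> V),
    [/\ forall x, N (rep x), forall x, cl (rep x) = x,
        forall u v, N u -> N v -> cl (u + v) = cl u + cl v
      & forall u, N u -> (cl u = 0 <-> N0 u)].
Proof.
move=> N_0 NB N0_0 N0B N0N.
have NN u : N u -> N (- u) by move=> Nu; rewrite -[- u]add0r; apply: NB.
have ND u v : N u -> N v -> N (u + v) by move=> Nu Nv; rewrite -[v]opprK; apply/NB/NN.
have N0O u : N0 u -> N0 (- u) by move=> Nu; rewrite -[- u]add0r; apply: N0B.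
have N0D u v : N0 u -> N0 v -> N0 (u + v).
  by move=> Nu Nv; rewrite -[v]opprK; apply/N0B/N0O.
have ex u : exists v, N0 (u - v) by exists u; rewrite subrr.
(* The choice depends on the predicate only, so congruent elements, which define the same coset, get
   the same representative. *)
pose pick (X : V -> Prop) : V := if pselect (exists v, X v) is left H then sval (cid H) else 0.
pose canon u := pick (fun v => N0 (u - v)).
have canonP u : N0 (u - canon u).
  by rewrite /canon /pick; case: pselect => [H|/(_ (ex u))] //; apply: (svalP (cid H)).
have canon_eq u v : N0 (u - v) -> canon u = canon v.
  move=> uv; congr pick; apply: funext => w; apply: propext; split=> nw.
    by rewrite -(subrK u v) -addrA; apply: N0D => //; rewrite -opprB; apply: N0O.
  by rewrite -(subrK v u) -addrA; apply: N0D.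
have canonN u : N u -> N (canon u).
  by move=> Nu; rewrite -[canon u](subKr u); apply: NB => //; apply/N0N/canonP.
have canonK u : canon (canon u) = canon u.
  by apply: canon_eq; rewrite -opprB; apply/N0O/canonP.
pose T := {u : V | `[< N u /\ canon u = u >]}.
have mkP u : N u -> `[< N (canon u) /\ canon (canon u) = canon u >].
  by move=> Nu; apply/asboolP; split; [exact: canonN | exact: canonK].
pose mk u (Nu : N u) : T := exist _ (canon u) (mkP u Nu).
have Nval (x : T) : N (val x) by case: x => u /= /asboolP [].
have canon_val (x : T) : canon (val x) = val x by case: x => u /= /asboolP [].
pose zero := mk 0 N_0.
pose add (x y : T) := mk (val x + val y) (ND _ _ (Nval x) (Nval y)).
pose opp (x : T) := mk (- val x) (NN _ (Nval x)).
have addA : associative add.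
  move=> x y z; apply: val_inj; apply: canon_eq => /=.
  have -> : val x + canon (val y + val z) - (canon (val x + val y) + val z) =
    (val x + val y - canon (val x + val y)) - (val y + val z - canon (val y + val z)).
    rewrite opprB !opprD -!addrA; congr (_ + _).
    by rewrite [RHS]addrC -!addrA [- val z + val y]addrC addKr addrCA.
  by apply: N0B; apply: canonP.
have addC : commutative add by move=> x y; apply: val_inj; rewrite /= addrC.
have add0 : left_id zero add.
  move=> x; apply: val_inj; rewrite /= -[RHS]canon_val; apply: canon_eq.
  by rewrite addrK -[canon 0]opprK -[- canon 0]add0r; apply/N0O/canonP.
have addN : left_inverse zero opp add.
  move=> x; apply: val_inj; apply: canon_eq; rewrite /= subr0.
  by have := N0O _ (canonP (- val x)); rewrite opprB opprK.
pose M : zmodType := HB.pack_for zmodType T (GRing.isZmodule.Build T addA addC add0 addN).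
pose cl (u : V) : M := if pselect (N u) is left Nu then mk u Nu else zero.
have clE u : N u -> val (cl u : T) = canon u by rewrite /cl; case: pselect.
exists M, cl, (fun x : M => val (x : T)); split=> [x|x|u v Nu Nv|u Nu].
- exact: Nval.
- by apply: val_inj; rewrite clE.
- apply: val_inj; rewrite /= !clE //; last exact: (ND u v).
  by apply: canon_eq; rewrite opprD addrACA; apply: N0D.
split=> [/(congr1 (fun x : M => val (x : T)))|N0u].
  rewrite clE //= => cu; have := N0B _ _ (canonP u) (canonP 0).
  by rewrite cu sub0r opprK subrK.
by apply: val_inj; rewrite clE //=; apply: canon_eq; rewrite subr0.
Qed.

Lemma module_action_restrict (R A : pzRingType) (iota : R -> A) (P : zmodType)
    (act : A -> P -> P) : ring_hom iota -> module_action act ->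
  module_action (fun r => act (iota r)).
Proof.
case=> i1 [iD iM] [act1 actDl actDr actM]; split=> [x|x a b|a|a b x].
- by rewrite i1.
- by rewrite iD actDl.
- exact: actDr.
- by rewrite iM actM.
Qed.

Lemma regular_action (A : pzRingType) : module_action (fun a x : A => a * x).
Proof.
split=> [x|x a b|a x y|a b x]; rewrite ?mul1r ?mulrDl ?mulrDr ?mulrA //.
Qed.

Section CompletedLocalization.
Variables (R : comPzRingType) (m : R -> Prop) (A : pzRingType) (iota : R -> A) (s : A).
Hypotheses (noeth : noetherian R) (idm : ideal m) (iotaP : alg_struct iota).

Let actA (r : R) (x : A) : A := iota r * x.
Let actAP : module_action actA.
Proof. by apply: (@module_action_restrict R A); [case: iotaP | exact: regular_action]. Qed.

Let F := fil m actA.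
Hypothesis flatA : flat actA.
Hypothesis commF : forall a, F 1 (s * a - a * s).

Let Fzero l : F l 0. Proof. exact: fil_zero. Qed.
Let FD l x y : F l x -> F l y -> F l (x + y). Proof. exact: filD. Qed.
Let FB l x y : F l x -> F l y -> F l (x - y). Proof. exact: filB. Qed.

Lemma fil_mull l a x : F l x -> F l (a * x).
Proof.
move: x; apply: fil_ind => [|r x mr].
  by split=> [|x y Fx Fy]; rewrite ?mulr0 ?mulrDr //; apply: FD.
by rewrite /actA mulrA; case: iotaP => _ <-; rewrite -mulrA; apply: fil_act.
Qed.

Lemma fil_mulr l a x : F l x -> F l (x * a).
Proof.
move: x; apply: fil_ind => [|r x mr].
  by split=> [|x y Fx Fy]; rewrite ?mul0r ?mulrDl //; apply: FD.
by rewrite /actA -mulrA; apply: fil_act.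
Qed.

(** [[s, r x] = r [s, x]] because scalars are central, and [[s, x]] already lies in [F 1]. *)
Lemma fil_commutator l x : F l x -> F l.+1 (s * x - x * s).
Proof.
move: x; apply: fil_ind => [|r x mr].
  split=> [|x y Fx Fy]; first by rewrite mulr0 mul0r subrr.
  by rewrite mulrDr mulrDl opprD addrACA; apply: FD.
have -> : s * actA r x - actA r x * s = actA r (s * x - x * s).
  by rewrite /actA mulrBr !mulrA; case: iotaP => _ /(_ r s) ->.
rewrite -addn1; move: (s * x - x * s) (commF x); apply: fil_ind => [|t y mt].
  split=> [|y z]; rewrite /actA ?mulr0 ?mulrDr //; exact: FD.
by case: actAP => _ _ _ <-; apply: fil_act; apply: ideal_powM.
Qed.

Let null_seq := null m actA.
(* u stands for the limit of u_k s^-k *)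
Let steady (u : nat -> A) := null_seq (fun k => u k.+1 - u k * s).

Lemma null_steady u : null_seq u -> steady u.
Proof.
move=> nu; apply: nullB => //; first exact: null_shift.
by apply: (null_map (f := fun x => x * s)) => // l x; apply: fil_mulr.
Qed.

(** Coefficients chosen term by term would not fit together. The defects [x_(k+1) - x_k s] are
    combinations too and tend to zero, so they have coefficients [c_k] tending to zero; [y] is
    rebuilt from [y_0] by [y_(k+1) = y_k s + c_k] and is steady by construction. *)
Lemma steady_lift p n (a : 'I_p -> 'I_n -> R) (x : 'I_n -> nat -> A) :
  lifting actA m a -> (forall i, steady (x i)) ->
  (forall k, exists y, combination actA a (x^~ k) y) ->
  exists y : 'I_p -> nat -> A, (forall j, steady (y j)) /\
    forall i k, x i k = \sum_j iota (a j i) * y j k.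
Proof.
move=> lifta stx comb.
pose d k i := x i k.+1 - x i k * s.
have dcomb k : exists y, combination actA a (d k) y.
  have [y yE] := comb k; have [z zE] := comb k.+1.
  exists (fun j => z j - y j * s) => i; rewrite /d yE zE mulr_suml -sumrB.
  by apply: eq_bigr => j _; rewrite /actA mulrBr mulrA.
have [||||c [cE cF]] := @decay_choice _ _ (combination actA a)
  (fun l u => forall i, F l (u i)) (fun l c => forall j, F l (c j)) d.
- by move=> i j y ij Fy h; apply: fil_le (Fy h).
- by move=> k; have [y yE] := dcomb k; exists y; split=> // j; apply: fil_top.
- move=> l; have [l' l'P] := lifta l; exists l' => k Fd.
  by have [c [Fc cE]] := l'P _ Fd (dcomb k); exists c.
- move=> l; have /choice [n' n'P] : forall i, exists n, forall k, (n <= k)%N -> F l (d k i).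
    by move=> i; apply: stx.
  exists (\max_i n' i)%N => k le i; apply: n'P; apply: leq_trans le; exact: leq_bigmax.
have [y0 y0E] := comb 0.
pose y j := fix y k := if k is k'.+1 then y k' * s + c k' j else y0 j.
have yS j k : y j k.+1 = y j k * s + c k j by [].
exists y; split=> [j l|i k].
  by have [n' n'P] := cF l; exists n' => k /n'P; rewrite yS addrAC subrr add0r; apply.
elim: k => [|k IH]; first exact: y0E.
rewrite -(subrK (x i k * s) (x i k.+1)) -/(d k i) cE IH mulr_suml -big_split.
by apply: eq_bigr => j _; rewrite /= mulrDr mulrA addrC.
Qed.

(** * The module of steady sequences modulo null sequences *)

Variables (M : zmodType) (cl : (nat -> A) -> M) (rep : M -> nat -> A).
Hypotheses (repP : forall x, steady (rep x)) (clK : forall x, cl (rep x) = x).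
Hypothesis clD : forall u v, steady u -> steady v -> cl (fun k => u k + v k) = cl u + cl v.
Hypothesis cl0P : forall u, steady u -> (cl u = 0 <-> null_seq u).

Lemma steadyD u v : steady u -> steady v -> steady (fun k => u k + v k).
Proof.
move=> su sv; apply: null_ext (nullD su sv) => k.
by rewrite mulrDl opprD addrACA.
Qed.

Lemma steadyN u : steady u -> steady (fun k => - u k).
Proof.
move=> su; apply: null_ext (nullN idm actAP su) => k.
by rewrite opprD mulNr.
Qed.

Lemma steadyB u v : steady u -> steady v -> steady (fun k => u k - v k).
Proof. by move=> su sv; apply/steadyD/steadyN. Qed.

Lemma steady_mull a u : steady u -> steady (fun k => a * u k).
Proof.
move=> su; have := null_map (f := fun x => a * x) (fun l x => @fil_mull l a x) su.
by apply: null_ext => k; rewrite mulrBr mulrA.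
Qed.

Lemma steady_sum n (u : 'I_n -> nat -> A) :
  (forall i, steady (u i)) -> steady (fun k => \sum_i u i k).
Proof.
move=> su; apply: null_ext (null_sum su) => k.
by rewrite mulr_suml sumrB.
Qed.

Lemma cl_eq u v : steady u -> steady v -> (cl u = cl v <-> null_seq (fun k => u k - v k)).
Proof.
move=> su sv; have sd := steadyB su sv; have -> : cl u = cl v + cl (fun k => u k - v k).
  by rewrite -clD //; congr cl; apply: funext => k; rewrite addrC subrK.
rewrite -(cl0P sd); split=> [/eqP|->]; last by rewrite addr0.
by rewrite -subr_eq0 addrC addKr => /eqP.
Qed.

Lemma cl_eventually n u v : steady u -> (forall k, (n <= k)%N -> u k = v k) ->
  steady v /\ cl v = cl u.
Proof.
move=> su uv; have sv : steady v.
  by apply: (@null_eventually _ _ _ _ n) su => k nk; rewrite !uv // leqW.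
split=> //; apply/cl_eq => //; apply: (@null_eventually _ _ _ _ n) (null0 _ _) => k nk.
by rewrite uv // subrr.
Qed.

Lemma cl_sum n (u : 'I_n -> nat -> A) :
  (forall i, steady (u i)) -> cl (fun k => \sum_i u i k) = \sum_i cl (u i).
Proof.
elim: n u => [|n IH] u su.
  rewrite big_ord0; apply/cl0P; first exact: steady_sum.
  by apply: null_ext (null0 _ _) => k; rewrite big_ord0.
rewrite big_ord_recr /= -IH // -clD //; last exact: steady_sum.
by congr cl; apply: funext => k; rewrite big_ord_recr.
Qed.

Lemma cl_surj x : exists u, steady u /\ x = cl u.
Proof. by exists (rep x). Qed.

Lemma rep_cl u : steady u -> null_seq (fun k => rep (cl u) k - u k).
Proof. by move=> su; apply/cl_eq. Qed.

Definition loc_act (a : A) (x : M) : M := cl (fun k => a * rep x k).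

Lemma loc_act_cl a u : steady u -> loc_act a (cl u) = cl (fun k => a * u k).
Proof.
move=> su; apply/cl_eq; do ?exact: steady_mull.
have := null_map (f := fun x => a * x) (fun l x => @fil_mull l a x) (rep_cl su).
by apply: null_ext => k; rewrite mulrBr.
Qed.

Lemma loc_actP : module_action loc_act.
Proof.
split=> [x|x a b|a x y|a b x].
- by rewrite /loc_act -[RHS]clK; congr cl; apply: funext => k; rewrite mul1r.
- rewrite /loc_act -clD; do ?exact: steady_mull.
  by congr cl; apply: funext => k; rewrite mulrDl.
- have [u [su ->]] := cl_surj x; have [v [sv ->]] := cl_surj y.
  rewrite -clD // !loc_act_cl //; last exact: steadyD.
  rewrite -clD; do ?exact: steady_mull.
  by congr cl; apply: funext => k; rewrite mulrDr.
- have [u [su ->]] := cl_surj x; rewrite !loc_act_cl //; last exact: steady_mull.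
  by congr cl; apply: funext => k; rewrite mulrA.
Qed.

Let actR (r : R) (x : M) : M := loc_act (iota r) x.

Lemma loc_actRP : module_action actR.
Proof. by apply: (@module_action_restrict R A); [case: iotaP | exact: loc_actP]. Qed.

Definition loc_fil l x := exists n, forall k, (n <= k)%N -> F l (rep x k).

Lemma loc_fil_cl l u : steady u ->
  loc_fil l (cl u) <-> exists n, forall k, (n <= k)%N -> F l (u k).
Proof.
move=> su; have [n nP] := rep_cl su l.
split=> -[n' n'P]; exists (maxn n n') => k; rewrite geq_max => /andP [nk n'k].
  by rewrite -[u k](subKr (rep (cl u) k)); apply: FB; [exact: n'P | exact: nP].
by rewrite -(subrK (u k) (rep _ k)); apply: FD; [exact: nP | exact: n'P].
Qed.

Lemma loc_fil_rep l x : loc_fil l x ->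
  exists u, [/\ steady u, cl u = x & forall k, F l (u k)].
Proof.
case=> n nP; pose u k := if (n <= k)%N then rep x k else 0.
have [su uE] : steady u /\ cl u = cl (rep x).
  by apply: (@cl_eventually n) => // k nk; rewrite /u nk.
by exists u; split=> // [|k]; rewrite ?uE ?clK // /u; case: ifP => // /nP.
Qed.

(** The substance is the passage from termwise to adic: if all [u_k] lie in [m^l A], their
    coefficients with respect to generators [t] of [m^l] must be chosen as steady sequences.
    [steady_lift] does this, its lifting condition being supplied by [fil_gens]. *)
Lemma loc_filE l x : fil m actR l x <-> loc_fil l x.
Proof.
split.
  move: x; apply: fil_ind => [|r x mr].
    split; first by have [n nP] := (cl0P (repP 0)).1 (clK 0) l; exists n.
    move=> x y [n nP] [n' n'P]; rewrite -[x]clK -[y]clK -clD //.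
    apply/loc_fil_cl; first exact: steadyD.
    exists (maxn n n') => k; rewrite geq_max => /andP [nk n'k].
    by apply: FD; [exact: nP | exact: n'P].
  apply/loc_fil_cl; first exact: steady_mull.
  by exists 0 => k _; apply: fil_act.
move=> /loc_fil_rep [u [su <- Fu]].
have [q [t tE]] := noeth (ideal_pow_ideal idm l).
have gens k v : F (l + k) v ->
    exists c : 'I_q -> A, (forall j, F k (c j)) /\ v = \sum_j actA (t j) (c j).
  exact: (fil_gens idm actAP).
pose a j (i : 'I_1) := t j.
have [|||y [sy yE]] := @steady_lift q 1 a (fun=> u).
- move=> k; exists (l + k)%N => v Fv _; have [c [Fc cE]] := gens k _ (Fv 0).
  by exists c; split=> // i; rewrite ord1.
- by [].
- move=> k; have [|c [_ cE]] := gens 0 (u k); first by rewrite addn0.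
  by exists c => i.
have -> : cl u = \sum_j actR (t j) (cl (y j)).
  transitivity (cl (fun k => \sum_j iota (t j) * y j k)).
    by congr cl; apply: funext => k; apply: (yE 0 k).
  rewrite cl_sum => [|j]; last exact: steady_mull.
  by apply: eq_bigr => j _; rewrite /actR loc_act_cl.
apply: fil_sum => j; apply: fil_act; apply/tE; exists (fun i => (i == j)%:R).
by rewrite (bigD1 j) //= eqxx mul1r big1 ?addr0 // => i /negPf ->; rewrite mul0r.
Qed.

Lemma loc_complete : madic_complete actR m.
Proof.
split=> [x fx|xs fxs].
  rewrite -[x]clK; apply/cl0P => // l; apply: (iffLR (loc_filE l x)).
  by apply: (@fil_le _ m _ actR _ l.+1) => //; apply: fx.
have /choice [u uP] : forall i, exists u,
    [/\ steady u, cl u = xs i.+1 - xs i & forall k, F i.+1 (u k)].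
  by move=> i; apply/loc_fil_rep/loc_filE/fxs.
have su i : steady (u i) by case: (uP i).
have uF i l k : (l <= i.+1)%N -> F l (u i k).
  by move=> li; apply: fil_le li _; case: (uP i) => _ _; apply.
(* Diagonal of the series of the [u i]. Modulo [F l] only the summands with [i < l] count, so
   steadiness and the limit reduce to finite sums. *)
pose v k := \sum_(i < k) u i k.
have sv : steady v.
  move=> l; have [n nP] := steady_sum (fun i : 'I_l => su i) l.
  exists (maxn n l) => k; rewrite geq_max => /andP [nk lk].
  pose f i := u i k.+1 - u i k * s.
  have -> : v k.+1 - v k * s = \sum_(i < k) f i + u k k.+1.
    by rewrite /v big_ord_recr /= addrAC mulr_suml sumrB.
  apply: FD; last by apply: uF; apply: leqW.
  rewrite -(big_mkord xpredT f) (big_cat_nat (n := l)) //=; apply: FD.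
    by have := nP k nk; rewrite mulr_suml -sumrB big_mkord.
  rewrite big_nat; apply: big_ind => [||i /andP [li _]]; [exact: Fzero | exact: FD |].
  by apply: FB; [|apply: fil_mulr]; apply: uF; apply: leqW.
exists (xs 0 + cl v) => j.
have -> : xs 0 + cl v - xs j = cl (fun k => v k - \sum_(i < j) u i k).
  have -> : xs j = xs 0 + cl (fun k => \sum_(i < j) u i k).
    rewrite cl_sum => [|i //]; elim: j => [|j IH]; first by rewrite big_ord0 addr0.
    by rewrite big_ord_recr /= addrA -IH; case: (uP j) => _ -> _; rewrite addrC subrK.
  have sj : steady (fun k => \sum_(i < j) u i k) by apply: steady_sum.
  have -> : cl v = cl (fun k => v k - \sum_(i < j) u i k) + cl (fun k => \sum_(i < j) u i k).
    by rewrite -clD //; [congr cl; apply: funext => k; rewrite subrK | exact: steadyB].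
  by rewrite opprD addrACA subrr add0r addrK.
apply/loc_filE/loc_fil_cl; first by apply: steadyB => //; apply: steady_sum.
exists j => k jk; rewrite /v -(big_mkord xpredT (fun i => u i k)).
rewrite (big_cat_nat (n := j)) //= big_mkord addrC addrK big_nat.
by apply: big_ind => [||i /andP [ji _]]; [exact: Fzero | exact: FD | exact: uF].
Qed.

(** On limits this is right multiplication by [s^-1]: the term [u_(k-1)] now stands before [s^-k].
    The value at 0 is arbitrary, as classes depend only on tails. *)
Let shift (u : nat -> A) k := if k is k'.+1 then u k' else 0.

Lemma null_shiftl u : null_seq u -> null_seq (shift u).
Proof. by move=> nu l; have [n nP] := nu l; exists n.+1 => -[|k] // /nP. Qed.

Lemma steady_shift u : steady u -> steady (shift u).
Proof.
by move=> su; apply: (@null_eventually _ _ _ _ 1) (null_shiftl su) => -[|k].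
Qed.

Let comm (u : nat -> A) k := s * u k - u k * s.

Lemma steady_comm u : steady u -> steady (comm u).
Proof.
move=> su; have cF l x : F l x -> F l (s * x - x * s).
  by move/fil_commutator; apply: fil_le.
apply: null_ext (null_map (f := fun x => s * x - x * s) cF su) => k.
rewrite /comm mulrBr !mulrBl !mulrA !opprB -!addrA; congr (_ + _).
by rewrite addrCA [RHS]addrCA; congr (_ + _); rewrite addrC.
Qed.

Lemma loc_s_bijective :
  (forall x, loc_act s x = 0 -> x = 0) /\ (forall y, exists x, loc_act s x = y).
Proof.
(* [T x] is [(s x - x s) s^-1], so [x + T x] is [s x s^-1]. Since the shift is invertible on
   classes, bijectivity of [1 + T] gives that of [s]. *)
pose T x := cl (shift (comm (rep x))).
have T_cl u : steady u -> T (cl u) = cl (shift (comm u)).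
  move=> su; apply/cl_eq; do ?[exact/steady_shift/steady_comm].
  have cF l x : F l x -> F l (s * x - x * s) by move/fil_commutator; apply: fil_le.
  have := null_shiftl (null_map (f := fun x => s * x - x * s) cF (rep_cl su)).
  apply: null_ext => -[|k] /=; first by rewrite subrr.
  rewrite /comm mulrBr mulrBl !opprB -!addrA; congr (_ + _).
  by rewrite addrCA [RHS]addrCA; congr (_ + _); rewrite addrC.
have TD : additive_map T.
  move=> x y; have [u [su ->]] := cl_surj x; have [v [sv ->]] := cl_surj y.
  rewrite -clD // !T_cl //; last exact: steadyD.
  rewrite -clD; do ?[exact/steady_shift/steady_comm].
  congr cl; apply: funext => -[|k] /=; first by rewrite addr0.
  by rewrite /comm mulrDr mulrDl opprD addrACA.
have TF l x : fil m actR l x -> fil m actR l.+1 (T x).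
  move=> /loc_filE [n nP]; apply/loc_filE/loc_fil_cl; first exact/steady_shift/steady_comm.
  by exists n.+1 => -[|k] // /nP; apply: fil_commutator.
have TE x : x + T x = cl (shift (fun k => s * rep x k)).
  rewrite -{1}[x]clK -clD //; last exact/steady_shift/steady_comm.
  apply/cl_eq.
  - by apply: steadyD => //; apply/steady_shift/steady_comm.
  - exact/steady_shift/steady_mull.
  apply: (@null_eventually _ _ _ _ 1) (null_shiftl (repP x)) => -[|k] //= _.
  by rewrite /comm -!addrA; congr (_ + _); rewrite addrCA subrr addr0.
have [surj inj] := neumann idm loc_actRP loc_complete TD TF.
split=> [x sx|y].
  apply: inj; rewrite TE; apply/cl0P; first exact/steady_shift/steady_mull.
  by apply/null_shiftl/cl0P => //; apply: steady_mull.
have [x] := surj (cl (shift (rep y))); rewrite TE => /cl_eq xy; exists x.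
rewrite -[y]clK; apply/cl_eq => //; first exact: steady_mull.
by apply: (null_shift (xy _ _)); [exact/steady_shift/steady_mull | exact: steady_shift].
Qed.

(** The element [s^-k], as the limit of [s^(j-k) s^-j]; truncated subtraction affects only the terms
    with [j < k]. *)
Definition loc_unit k : M := cl (fun j => s ^+ (j - k)).

Lemma steady_unit k : steady (fun j => s ^+ (j - k)).
Proof.
apply: (@null_eventually _ _ _ _ k) (null0 _ _) => j kj.
by rewrite subSn // exprSr subrr.
Qed.

Lemma loc_unitS k : loc_act s (loc_unit k.+1) = loc_unit k.
Proof.
rewrite loc_act_cl; last exact: steady_unit.
case: (@cl_eventually k.+1 _ (fun j => s * s ^+ (j - k.+1)) (steady_unit k)) => [j kj|//].
by rewrite -exprS -subSn // subSS.
Qed.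

(** Cutting a steady sequence at a late stage [n] and continuing it by right multiplication by [s]
    changes the limit by an element of [m^l M]; the continued sequence represents [rep x n] times
    [s^-n]. *)
Lemma loc_dense x l : exists a k, fil m actR l (x - loc_act a (loc_unit k)).
Proof.
have [n nP] := repP x l; exists (rep x n), n; apply/loc_filE.
have su := steady_mull (rep x n) (@steady_unit n).
rewrite loc_act_cl; last exact: steady_unit.
have -> : x - cl (fun j => rep x n * s ^+ (j - n)) = cl (fun j => rep x j - rep x n * s ^+ (j - n)).
  apply/eqP; rewrite subr_eq; apply/eqP; rewrite -clD //; last exact: steadyB.
  by rewrite -[LHS]clK; congr cl; apply: funext => j; rewrite subrK.
apply/loc_fil_cl; first exact: steadyB.
exists n => j /subnK <-; rewrite addnK; elim: (j - n)%N => [|i IH].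
  by rewrite mulr1 subrr.
rewrite addSn -(subrK (rep x (i + n)%N * s) (rep x (i + n).+1)) -addrA.
apply: FD; first by apply: nP; apply: leq_addl.
by rewrite exprSr mulrA -mulrBl; apply: fil_mulr.
Qed.

(** A relation in [M] holds termwise only up to a null sequence. That error is removed first; then
    flatness of [A] writes each term through fixed generators [g] of the module [Z] of relations of
    [r], and [steady_lift] makes the coefficients steady. Fixing [g] in advance keeps the matrix [a]
    independent of the term [k]. *)
Lemma loc_flat : flat actR.
Proof.
move=> n r x rel; have noethZ := @noetherian_rV R n noeth.
pose Z (z : 'rV[R]_n) := \sum_i r i * z 0 i = 0.
have [|p [g [Zg gen]]] := noethZ Z.
  split; [split | move=> c y Zy]; rewrite /Z.
  - by rewrite big1 // => i _; rewrite mxE mulr0.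
  - move=> y z Zy Zz; under eq_bigr do rewrite mxE mulrDr.
    by rewrite big_split /= Zy Zz addr0.
  - under eq_bigr do rewrite mxE mulrCA.
    by rewrite -mulr_sumr Zy mulr0.
pose a j i := g j 0 i.
have liftings q n' (b : 'I_q -> 'I_n' -> R) : lifting actA m b.
  exact: (flat_artin_rees actAP flatA noeth idm).
pose b j (i : 'I_1) := r j.
pose w k (i : 'I_1) := \sum_j iota (r j) * rep (x j) k.
have wnull : null_seq (w^~ 0).
  apply/cl0P; first by apply: steady_sum => j; apply: steady_mull.
  rewrite -rel cl_sum => [|j]; last exact: steady_mull.
  by apply: eq_bigr => j _.
have [||||z [zE zF]] := @decay_choice _ _ (combination actA b)
  (fun l u => forall i, F l (u i)) (fun l c => forall j, F l (c j)) w.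
- by move=> i j y ij Fy h; apply: fil_le (Fy h).
- by move=> k; exists (fun j => rep (x j) k); split=> // j; apply: fil_top.
- move=> l; have [l' l'P] := liftings _ _ b l; exists l' => k Fd.
  by have [|c [Fc cE]] := l'P _ Fd; [exists (fun j => rep (x j) k) | exists c].
- by move=> l; have [N NP] := wnull l; exists N => k Nk i; rewrite ord1; apply: NP.
(* Same class as [x i], since [z] is null, but now the relation with coefficients [r] holds exactly
   at every term. *)
pose x' i k := rep (x i) k - z k i.
have zn i : null_seq (z^~ i) by move=> l; have [N NP] := zF l; exists N => k /NP; apply.
have sx' i : steady (x' i) by apply: steadyB => //; apply: null_steady.
have [//|k|y [sy yE]] := @steady_lift p n a x' (liftings _ _ a).
  have [|q [c [v [vE cE]]]] := flatA (r := r) (x := x'^~ k).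
    transitivity (w k 0 - w k 0); last exact: subrr.
    rewrite {2}zE /w -sumrB; apply: eq_bigr => i _.
    by rewrite /x' /actA mulrBr.
  have /choice [d dE] : forall h, exists d : 'I_p -> R, forall i, c i h = \sum_j d j * a j i.
    move=> h; have [|d dE] := gen (\row_i c i h).
      by rewrite /Z; under eq_bigr do rewrite mxE; apply: cE.
    exists d => i; have := congr1 (fun u : 'rV[R]_n => u 0 i) dE.
    by rewrite mxE summxE => ->; apply: eq_bigr => j _; rewrite mxE.
  exists (fun j => \sum_h actA (d h j) (v h)) => i; rewrite vE.
  under [RHS]eq_bigr do rewrite (act_sumr _ _ actAP).
  rewrite exchange_big; apply: eq_bigr => h _; rewrite dE (act_suml _ _ actAP).
  by apply: eq_bigr => j _; rewrite mulrC; case: actAP.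
exists p, (fun i j => a j i), (fun j => cl (y j)); split=> [i|j]; last exact: Zg.
transitivity (cl (fun k => \sum_j iota (a j i) * y j k)).
  have -> : (fun k => \sum_j iota (a j i) * y j k) = x' i by apply: funext => k.
  rewrite -{1}[x i]clK; apply/cl_eq => //.
  by apply: null_ext (zn i) => k; rewrite /x' subKr.
rewrite cl_sum => [|j]; last exact: steady_mull.
by apply: eq_bigr => j _; rewrite /actR loc_act_cl.
Qed.

(** With [y_k] an iterated preimage of [y] under [s], in the role of [s^-k y], the value at [cl u]
    is the limit of [u_k y_k]. It exists because [u_(k+1) y_(k+1) - u_k y_k = (u_(k+1) - u_k s)
    y_(k+1)]. *)
Lemma loc_extend (P : zmodType) (actP : A -> P -> P) (y : P) :
  module_action actP -> madic_complete (fun r => actP (iota r)) m ->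
  (forall z, exists x, actP s x = z) ->
  exists f : M -> P, [/\ additive_map f, forall a x, f (loc_act a x) = actP a (f x)
                       & f (loc_unit 0) = y].
Proof.
move=> actPP compl /choice [inv invK].
have RP : module_action (fun r => actP (iota r)).
  by apply: module_action_restrict => //; case: iotaP.
have [act1 actDl actDr actM] := actPP.
pose y_ k := iter k inv y.
have Fact l a z : F l a -> fil m (fun r => actP (iota r)) l (actP a z).
  move: a; apply: fil_ind => [|r a mr]; last by rewrite actM; apply: fil_act.
  split=> [|a b fa fb]; rewrite ?(act0l _ actPP) ?actDl.
    exact: fil_zero.
  exact: filD.
have /choice [f fP] : forall x, exists z,
    null m (fun r => actP (iota r)) (fun k => actP (rep x k) (y_ k) - z).
  move=> x; apply: cauchy_converges => // l; have [n nP] := repP x l.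
  exists n => k /nP Fk.
  rewrite -[y_ k]invK -actM -[X in _ - X]/(actP _ (y_ k.+1)) -(actNl _ _ actPP) -actDl.
  exact: Fact.
have f_cl u : steady u ->
    null m (fun r => actP (iota r)) (fun k => actP (u k) (y_ k) - f (cl u)).
  move=> su; have n1 : null m (fun r => actP (iota r))
      (fun k => actP (u k - rep (cl u) k) (y_ k)).
    move=> l; have [n nP] := rep_cl su l; exists n => k /nP Fk.
    by apply: Fact; rewrite -opprB; apply: filN.
  apply: null_ext (nullD n1 (fP (cl u))) => k.
  by rewrite addrA -actDl subrK.
have limit u z : steady u ->
    null m (fun r => actP (iota r)) (fun k => actP (u k) (y_ k) - z) -> f (cl u) = z.
  move=> su nz; apply/eqP; rewrite -subr_eq0; apply/eqP/(null_cst compl).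
  apply: null_ext (nullB idm RP nz (f_cl u su)) => k.
  by rewrite opprB addrC addrA subrK.
exists f; split=> [x1 x2|a x|].
- have [u [su ->]] := cl_surj x1; have [v [sv ->]] := cl_surj x2.
  rewrite -clD //; apply: limit; first exact: steadyD.
  apply: null_ext (nullD (f_cl u su) (f_cl v sv)) => k.
  by rewrite actDl opprD addrACA.
- have [u [su ->]] := cl_surj x; rewrite loc_act_cl //.
  apply: limit; first exact: steady_mull.
  have aF l z : fil m (fun r => actP (iota r)) l z -> fil m (fun r => actP (iota r)) l (actP a z).
    move: z; apply: fil_ind => [|r z mr].
      split=> [|z1 z2 f1 f2]; rewrite ?(additive_map0 (actDr a)) ?actDr.
        exact: fil_zero.
      exact: filD.
    by rewrite -actM; case: iotaP => _ <-; rewrite actM; apply: fil_act.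
  apply: null_ext (null_map aF (f_cl u su)) => k.
  by rewrite (additive_mapB (actDr a)) actM.
apply: limit; first exact: steady_unit.
apply: null_ext (null0 _ _) => k; rewrite subn0.
suff -> : actP (s ^+ k) (y_ k) = y by rewrite subrr.
by elim: k => [|k IH]; rewrite ?act1 // exprSr actM /= invK.
Qed.

End CompletedLocalization.

(** * The ring structure *)

Section DenseUnique.
Variables (R : comPzRingType) (m : R -> Prop) (A : pzRingType) (iota : R -> A) (s : A).
Hypotheses (idm : ideal m) (iotaP : ring_hom iota).

Definition separated (P : zmodType) (actP : A -> P -> P) : Prop :=
  forall x, (forall l, fil m (fun r => actP (iota r)) l x) -> x = 0.

Variables (M P : zmodType) (actM : A -> M -> M) (actP : A -> P -> P) (e : nat -> M).
Hypotheses (actPP : module_action actP) (sep : separated actP).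
Hypothesis injP : forall x, actP s x = 0 -> x = 0.
Hypothesis eS : forall k, actM s (e k.+1) = e k.
Hypothesis dense : forall x l, exists a k,
  fil m (fun r => actM (iota r)) l (x - actM a (e k)).

(** Injectivity of [s] on [P] propagates the zero from [e 0] to every [e k], which plays [s^-k];
    density and separatedness conclude. *)
Lemma dense_zero (f : M -> P) : additive_map f ->
  (forall a x, f (actM a x) = actP a (f x)) -> f (e 0) = 0 -> forall x, f x = 0.
Proof.
move=> fD fM f0 x; have fe k : f (e k) = 0.
  by elim: k => // k IH; apply: injP; rewrite -fM eS.
apply: sep => l; have [a [k Fx]] := dense x l.
rewrite -(subrK (actM a (e k)) x) fD fM fe.
have [_ _ actDr _] := actPP; rewrite (additive_map0 (actDr a)) addr0.
move: Fx; move: (x - _) => y; move: y; apply: fil_ind => [|r y mr]; last first.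
  by rewrite fM; apply: fil_act.
split=> [|y z fy fz]; rewrite ?(additive_map0 fD) ?fD; first exact: fil_zero.
exact: filD.
Qed.

Lemma dense_unique (f1 f2 : M -> P) : additive_map f1 -> additive_map f2 ->
  (forall a x, f1 (actM a x) = actP a (f1 x)) ->
  (forall a x, f2 (actM a x) = actP a (f2 x)) -> f1 (e 0) = f2 (e 0) -> f1 =1 f2.
Proof.
move=> D1 D2 M1 M2 e12 x; apply/eqP; rewrite -subr_eq0; apply/eqP.
apply: (dense_zero (f := fun x => f1 x - f2 x)) => [y z|a y|].
- by rewrite D1 D2 opprD addrACA.
- have [_ _ actDr _] := actPP; rewrite M1 M2.
  by rewrite (additive_mapB (actDr a)).
- by rewrite e12 subrr.
Qed.

End DenseUnique.

(** [loc_universal] records existence only; uniqueness will follow from the density clause of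
    [loc_inverse]. *)
Record completed_localization (R : comPzRingType) (m : R -> Prop) (A : pzRingType)
    (iota : R -> A) (s : A) (A' : pzRingType) (g : A -> A') : Prop := {
  loc_hom : ring_hom g;
  loc_alg : alg_struct (fun r => g (iota r));
  loc_isflat : flat (fun r (x : A') => g (iota r) * x);
  loc_iscomplete : madic_complete (fun r (x : A') => g (iota r) * x) m;
  loc_inverse : exists t, [/\ g s * t = 1, t * g s = 1 &
    forall x l, exists a k, fil m (fun r (x : A') => g (iota r) * x) l (x - g a * t ^+ k)];
  loc_universal : forall (P : zmodType) (actP : A -> P -> P) (y : P),
    module_action actP -> madic_complete (fun r => actP (iota r)) m ->
    (forall z, exists x, actP s x = z) ->
    exists f : A' -> P, [/\ additive_map f, forall a x, f (g a * x) = actP a (f x) & f 1 = y]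
}.

Lemma complete_separated (R : comPzRingType) (m : R -> Prop) (A : pzRingType)
    (iota : R -> A) (P : zmodType) (actP : A -> P -> P) :
  madic_complete (fun r => actP (iota r)) m -> separated m iota actP.
Proof. by move=> compl x; apply: fil_separated. Qed.

(* The module M of limits of u_k s^-k is initial among complete A-modules with a
   marked point on which s is bijective. Hence x * y can be defined as the value at
   x of the endomorphism sending 1 to y, and ring axioms are uniqueness statements. *)
Lemma completed_localization_exists (R : comPzRingType) (m : R -> Prop) (A : pzRingType)
    (iota : R -> A) (s : A) : noetherian R -> ideal m -> alg_struct iota ->
  flat (fun r (x : A) => iota r * x) ->
  (forall a, fil m (fun r (x : A) => iota r * x) 1 (s * a - a * s)) ->
  exists (A' : pzRingType) (g : A -> A'), completed_localization m iota s g.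
Proof.
move=> noeth idm iotaP flatA commF.
pose actA r (x : A) := iota r * x.
have actAP : module_action actA.
  by apply: (@module_action_restrict R A); [case: iotaP | exact: regular_action].
pose N (u : nat -> A) := null m actA (fun k => u k.+1 - u k * s).
have [|u v Nu Nv||u v Nu Nv|u Nu|[T cT] [cl [rep [repP clK clD cl0P]]]] :=
  @subquotient (nat -> A) N (null m actA).
- by apply: null_ext (null0 _ _) => k; rewrite -[RHS]/(0 - 0 * s) mul0r subrr.
- apply: null_ext (nullB idm actAP Nu Nv) => k.
  rewrite -[RHS]/(u k.+1 - v k.+1 - (u k - v k) * s).
  by rewrite mulrBl !opprB -!addrA; congr (_ + _); rewrite addrCA [RHS]addrCA;
     congr (_ + _); rewrite addrC.
- exact: null0.
- exact: nullB.
- exact: null_steady.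
pose M : zmodType := GRing.Zmodule.Pack cT.
pose act : A -> M -> M := loc_act cl rep; pose e : nat -> M := loc_unit s cl.
have actP : module_action act by exact: (loc_actP idm iotaP repP clK clD cl0P).
have compl : madic_complete (fun r => act (iota r)) m.
  exact: (loc_complete noeth idm iotaP repP clK clD cl0P).
have flatM : flat (fun r => act (iota r)).
  exact: (loc_flat noeth idm iotaP flatA repP clK clD cl0P).
have [inj surj] : (forall x, act s x = 0 -> x = 0) /\ (forall y, exists x, act s x = y).
  exact: (loc_s_bijective noeth idm iotaP commF repP clK clD cl0P).
have eS k : act s (e k.+1) = e k by exact: (loc_unitS idm iotaP repP clK clD cl0P).
have dense x l : exists a k, fil m (fun r => act (iota r)) l (x - act a (e k)).
  exact: (loc_dense noeth idm iotaP repP clK clD cl0P).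
have ext (P : zmodType) (aP : A -> P -> P) (y : P) : module_action aP ->
    madic_complete (fun r => aP (iota r)) m -> (forall z, exists x, aP s x = z) ->
    exists f : M -> P, [/\ additive_map f, forall a x, f (act a x) = aP a (f x) & f (e 0) = y].
  exact: (loc_extend idm iotaP repP clK clD cl0P).
have [act1 actDl actDr actM] := actP.
have uniq (f1 f2 : M -> M) : additive_map f1 -> additive_map f2 ->
    (forall a x, f1 (act a x) = act a (f1 x)) ->
    (forall a x, f2 (act a x) = act a (f2 x)) -> f1 (e 0) = f2 (e 0) -> f1 =1 f2.
  exact: (dense_unique actP (complete_separated compl) inj eS dense).
have /choice [F FP] : forall y, exists f : M -> M,
    [/\ additive_map f, forall a x, f (act a x) = act a (f x) & f (e 0) = y].
  by move=> y; apply: ext.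
have FD y : additive_map (F y) by case: (FP y).
have FM y a x : F y (act a x) = act a (F y x) by case: (FP y).
have F1 y : F y (e 0) = y by case: (FP y).
pose mul x y := F y x.
have mulA : associative mul.
  move=> x y z; rewrite /mul; move: x; apply: uniq; rewrite ?F1 //.
  - by move=> u v; rewrite !FD.
  - by move=> a u; rewrite !FM.
have mul1 : left_id (e 0) mul by move=> x; rewrite /mul F1.
have mul_1 : right_id (e 0) mul by apply: (uniq (F (e 0)) id).
have mulDl : left_distributive mul +%R by move=> x y z; rewrite /mul FD.
have mulDr : right_distributive mul +%R.
  move=> x y z; rewrite /mul; move: x.
  apply: (uniq _ (fun x => F y x + F z x)); rewrite ?F1 //.
  - by move=> u v; rewrite !FD addrACA.
  - by move=> a u; rewrite !FM actDr.
pose A' : pzRingType := HB.pack_for pzRingType T cT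
  (GRing.Zmodule_isPzRing.Build M mulA mul1 mul_1 mulDl mulDr).
pose g a : A' := act a (e 0).
have gE a (x : A') : g a * x = act a x by rewrite -[LHS]/(F x (act a (e 0))) FM F1.
have gact r : (fun x : A' => g (iota r) * x) = act (iota r).
  by apply: funext => x; apply: gE.
have gactE : (fun r (x : A') => g (iota r) * x) = (fun r => act (iota r)).
  by apply: funext => r; apply: gact.
(* The action of [iota r] on [M] is itself [A]-linear, [iota r] being central in [A], and it agrees
   with [F (g (iota r))] at the unit. *)
have central r (x : A') : g (iota r) * x = x * g (iota r).
  rewrite gE -[RHS]/(F (g (iota r)) x); move: x.
  apply: uniq; rewrite ?F1 //.
  by move=> a x; rewrite -!actM; case: iotaP => _ ->.
have g_hom : ring_hom g.
  split; first exact: act1.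
  by split=> [a b|a b]; [exact: actDl | rewrite gE /g actM].
have [t st] := surj (e 0).
have gst : g s * (t : A') = 1 by rewrite gE.
(* [t] is a right inverse by construction; [g s * (t * g s - 1) = 0] and injectivity of [s] make it
   two-sided. *)
have tgs : (t : A') * g s = 1.
  apply/eqP; rewrite -subr_eq0; apply/eqP/inj.
  by rewrite -[act s _]gE mulrBr mulrA gst mul1r mulr1 subrr.
have te k : (t : A') ^+ k = e k.
  elim: k => [|k IH] //; rewrite exprS IH -(eS k) -[act s _](gE s).
  by rewrite mulrA tgs mul1r.
exists A', g; split=> //.
- split=> //; case: g_hom => g1 [gD gM]; case: iotaP => -[i1 [iD iM]] _.
  by split; [rewrite i1 | split=> a b; rewrite ?iD ?iM ?gD ?gM].
- by rewrite gactE.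
- by rewrite gactE.
- exists t; split=> // x l; have [a [k ak]] := dense x l; exists a, k.
  by rewrite gactE te gE.
move=> P aP y aPP cP sP; have [f [fD fM f1]] := ext P aP y aPP cP sP.
by exists f; split=> // a x; rewrite gE.
Qed.

(** * Localizing associative deformations *)

Lemma idl_modW (R : comPzRingType) (M : zmodType) (act : R -> M -> M)
    (I J : R -> Prop) x : (forall r, I r -> J r) -> idl_mod act I x -> idl_mod act J x.
Proof. by move=> IJ [n [r [y [Ir ->]]]]; exists n, r, y; split=> // i; apply: IJ. Qed.

Lemma fil1E (R : comPzRingType) (m : R -> Prop) (M : zmodType) (act : R -> M -> M) x :
  ideal m -> (fil m act 1 x <-> idl_mod act m x).
Proof. by move=> idm; split; apply: idl_modW => r /(ideal_pow1 idm). Qed.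

(** The filtration vanishes from level 1 on, so compatible families are constant. This makes [C'] an
    admissible target for the universal property. *)
Lemma torsion_complete (R : comPzRingType) (m : R -> Prop) (M : zmodType)
    (act : R -> M -> M) : ideal m -> module_action act ->
  (forall r x, m r -> act r x = 0) -> madic_complete act m.
Proof.
move=> idm actP tors; have fil0 i x : fil m act i.+1 x -> x = 0.
  move: x; apply: fil_ind => [|r x mr]; first by split=> // x y -> ->; rewrite addr0.
  by apply: tors; apply/(ideal_pow1 idm); apply: ideal_pow_le mr.
split=> [x fx|xs fxs]; first exact: (fil0 0 x (fx 0)).
exists (xs 0) => i; suff -> : xs 0 = xs i by rewrite subrr; apply: fil_zero.
by elim: i => // i ->; apply/esym/eqP; rewrite -subr_eq0; apply/eqP/(fil0 i)/fxs.
Qed.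

(** * Complete algebras and lifting of units *)

Section Algebras.
Variables (R : comPzRingType) (m : R -> Prop) (B : pzRingType) (iB : R -> B).
Hypotheses (idm : ideal m) (iBP : alg_struct iB).

Lemma algebra_action : module_action (fun r (x : B) => iB r * x).
Proof. by apply: (@module_action_restrict R B); [case: iBP | exact: regular_action]. Qed.

Lemma fil_prod i j (x y : B) : fil m (fun r (x : B) => iB r * x) i x ->
  fil m (fun r (x : B) => iB r * x) j y -> fil m (fun r (x : B) => iB r * x) (i + j) (x * y).
Proof.
move=> fx fy; move: x fx; apply: fil_ind => [|r x mr].
  split=> [|a b fa fb]; rewrite ?mul0r ?mulrDl; first exact: fil_zero.
  exact: filD.
rewrite -mulrA; move: (x * y) (fil_mull iBP x fy); apply: fil_ind => [|t z mt].
  split=> [|a b fa fb]; rewrite ?mulr0 ?mulrDr; first exact: fil_zero.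
  exact: filD.
have [_ _ _ actM] := algebra_action; rewrite -actM.
by apply: fil_act; apply: ideal_powM.
Qed.

Hypothesis compl : madic_complete (fun r (x : B) => iB r * x) m.

Lemma one_plus_bijective (w : B) : fil m (fun r (x : B) => iB r * x) 1 w ->
  (forall y, exists x, (1 + w) * x = y) /\ (forall x, (1 + w) * x = 0 -> x = 0).
Proof.
move=> fw; have [|l x fx|surj inj] :=
  @neumann _ m _ _ idm algebra_action compl (fun x => w * x).
- by move=> x y; rewrite mulrDr.
- by rewrite -add1n; apply: fil_prod.
split=> [y|x]; last by rewrite mulrDl mul1r; apply: inj.
by have [x <-] := surj y; exists x; rewrite mulrDl mul1r.
Qed.

(** For a lift [v] of the inverse, [b v] and [v b] are congruent to 1 modulo [m]. Surjectivity of
    multiplication by [b v] yields a right inverse [v z] of [b], and injectivity of multiplication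
    by [v b] shows that it is also a left inverse. *)
Lemma unit_lift (C : comPzRingType) (pi : B -> C) (b : B) (u : C) : ring_hom pi ->
  (forall y, exists a, pi a = y) ->
  (forall a, pi a = 0 <-> idl_mod (fun r (x : B) => iB r * x) m a) ->
  pi b * u = 1 -> exists v, b * v = 1 /\ v * b = 1.
Proof.
move=> [p1 [pD pM]] surj ker bu; have [v vu] := surj u.
have near1 x : pi x = 1 -> fil m (fun r (x : B) => iB r * x) 1 (x - 1).
  move=> px; apply/fil1E => //; apply/ker.
  by rewrite (additive_mapB pD) px p1 subrr.
have [|surj1 _] := @one_plus_bijective (b * v - 1); first by apply: near1; rewrite pM vu.
have [|_ inj2] := @one_plus_bijective (v * b - 1).
  by apply: near1; rewrite pM vu mulrC.
rewrite addrC subrK in surj1; rewrite addrC subrK in inj2.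
have [z bz] := surj1 1; exists (v * z); split; first by rewrite mulrA.
apply/eqP; rewrite -subr_eq0; apply/eqP/inj2.
by rewrite mulrBr mulr1 -!mulrA [b * (v * _)]mulrA [b * v * _]mulrA bz mul1r subrr.
Qed.

End Algebras.

Section Localized.
Variables (R : comPzRingType) (m : R -> Prop) (A : pzRingType) (iota : R -> A) (s : A).
Variables (A' : pzRingType) (g : A -> A').
Hypotheses (idm : ideal m) (iotaP : alg_struct iota).
Hypothesis loc : completed_localization m iota s g.

Lemma loc_unique (P : zmodType) (actP : A -> P -> P) (f1 f2 : A' -> P) :
  module_action actP -> separated m iota actP -> (forall x, actP s x = 0 -> x = 0) ->
  additive_map f1 -> additive_map f2 ->
  (forall a x, f1 (g a * x) = actP a (f1 x)) ->
  (forall a x, f2 (g a * x) = actP a (f2 x)) -> f1 1 = f2 1 -> f1 =1 f2.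
Proof.
move=> actPP sep inj D1 D2 M1 M2 f12; have [t [gst tgs dense]] := loc_inverse loc.
apply: (@dense_unique R m A iota s A' P (fun a x => g a * x) actP (fun k => t ^+ k)) => //.
by move=> k; rewrite exprS mulrA gst mul1r.
Qed.

Section Target.
Variables (B : pzRingType) (iB : R -> B) (h : A -> B).
Hypotheses (iBP : alg_struct iB) (hP : alg_hom iota iB h).
Hypothesis compl : madic_complete (fun r (x : B) => iB r * x) m.
Hypothesis unit_hs : exists v, h s * v = 1 /\ v * h s = 1.

Let act a (x : B) := h a * x.

Lemma target_restrict : (fun r => act (iota r)) = (fun r (x : B) => iB r * x).
Proof.
apply: funext => r; apply: funext => x; rewrite /act; congr (_ * _).
by case: hP => -[h1 _] hM; rewrite -[iota r]mulr1 hM h1 mulr1.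
Qed.

Lemma target_action : module_action act.
Proof. by apply: module_action_restrict; [case: hP | exact: regular_action]. Qed.

Lemma target_complete : madic_complete (fun r => act (iota r)) m.
Proof. by rewrite target_restrict. Qed.

Lemma target_unique (f1 f2 : A' -> B) : additive_map f1 -> additive_map f2 ->
  (forall a x, f1 (g a * x) = h a * f1 x) ->
  (forall a x, f2 (g a * x) = h a * f2 x) -> f1 1 = f2 1 -> f1 =1 f2.
Proof.
apply: (loc_unique (actP := act)); first exact: target_action.
  exact: (complete_separated target_complete).
have [v [_ vh]] := unit_hs => x hx.
by rewrite -[x]mul1r -vh -mulrA -/(act s x) hx mulr0.
Qed.

(** [B] is an [A]-module through [h], and [f] is the linear map with [f 1 = 1]. It is multiplicative
    since, for fixed [y], [f (x * y)] and [f x * f y] are [A]-linear in [x] and agree at 1. *)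
Lemma hom_extend : exists g' : A' -> B,
  alg_hom (fun r => g (iota r)) iB g' /\ (forall a, h a = g' (g a)).
Proof.
have [z|f [fD fM f1]] := loc_universal loc 1 target_action target_complete.
  by have [v [hv _]] := unit_hs; exists (v * z); rewrite /act mulrA hv mul1r.
have [[h1 _] hM] := hP.
exists f; split; last by move=> a; rewrite -[g a]mulr1 fM f1 /act mulr1.
split; last by move=> r x; rewrite fM -[act (iota r)]/((fun r => act (iota r)) r) target_restrict.
split=> //; split=> // x y; move: x.
apply: (target_unique (f1 := fun x => f (x * y)) (f2 := fun x => f x * f y)).
- by move=> a b; rewrite mulrDl fD.
- by move=> a b; rewrite fD mulrDl.
- by move=> a b; rewrite -mulrA fM.
- by move=> a b; rewrite fM mulrA.
- by rewrite f1 !mul1r.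
Qed.

Lemma hom_unique (g1 g2 : A' -> B) : ring_hom g1 -> ring_hom g2 ->
  (forall a, h a = g1 (g a)) -> (forall a, h a = g2 (g a)) -> g1 =1 g2.
Proof.
move=> [e1 [D1 M1]] [e2 [D2 M2]] h1 h2; apply: target_unique => //.
- by move=> a x; rewrite M1 h1.
- by move=> a x; rewrite M2 h2.
- by rewrite e1 e2.
Qed.

End Target.

Lemma loc_alg_hom : alg_hom iota (fun r => g (iota r)) g.
Proof. by case: (loc_hom loc) => g1 [gD gM]; split=> // r a; rewrite gM. Qed.

(** Uniqueness is used twice. Commutativity of [A] makes [g a * x] [A]-linear in [x], as [x * g a]
    always is, so the image of [A] is central; this in turn makes [y * x] [A]-linear in [x]. *)
Lemma loc_commutative : (forall a b : A, a * b = b * a) -> forall x y : A', x * y = y * x.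
Proof.
move=> comm; have [g1 [gD gM]] := loc_hom loc.
have uniq := @target_unique A' (fun r => g (iota r)) g loc_alg_hom (loc_iscomplete loc).
have unit_gs : exists v, g s * v = 1 /\ v * g s = 1.
  by have [t [gst tgs _]] := loc_inverse loc; exists t.
have gC a x : g a * x = x * g a.
  move: x; apply: (uniq unit_gs) => [x y|x y|b x|b x|].
  - by rewrite mulrDr.
  - by rewrite mulrDl.
  - by rewrite !mulrA -!gM comm.
  - by rewrite mulrA.
  - by rewrite mul1r mulr1.
move=> x y; move: x; apply: (uniq unit_gs) => [a b|a b|a x|a x|].
- by rewrite mulrDl.
- by rewrite mulrDr.
- by rewrite mulrA.
- by rewrite !mulrA gC.
- by rewrite mul1r mulr1.
Qed.

End Localized.

Lemma parameter_ideal (K : fieldType) (R : comPzRingType) (kR : K -> R) (m : R -> Prop) :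
  parameter_algebra kR m -> ideal m.
Proof. by case=> _ [[[]]]. Qed.

Lemma deformation_localization (K : fieldType) (R : comPzRingType) (kR : K -> R)
    (m : R -> Prop) (C C' : comPzRingType) (kC : K -> C) (kC' : K -> C') (tau : C -> C')
    (A : pzRingType) (iota : R -> A) (pi : A -> C) :
  parameter_algebra kR m -> Kalg_hom kC kC' tau -> principal_localization tau ->
  assoc_deformation kR m kC iota pi ->
  exists (s : A) (A' : pzRingType) (g : A -> A') (pi' : A' -> C'),
    [/\ completed_localization m iota s g, exists u, tau (pi s) * u = 1,
        assoc_deformation kR m kC' (fun r => g (iota r)) pi' & lifts pi pi' tau g].
Proof.
move=> hR [[tau1 [tauD tauM]] tauK] [c [[u cu] [frac tors]]].
move=> [iotaP [flatA [complA [[pi1 [piD piM]] [piK [pi_surj pi_ker]]]]]].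
have idm := parameter_ideal hR; have [_ [_ [noeth _]]] := hR.
have [s sc] := pi_surj c.
have commF a : fil m (fun r (x : A) => iota r * x) 1 (s * a - a * s).
  by apply/fil1E => //; apply/pi_ker; rewrite (additive_mapB piD) !piM mulrC subrr.
have [A' [g loc]] := completed_localization_exists noeth idm iotaP flatA commF.
(* [R] acts on [C'] through [A]. As [m] acts by zero, [C'] is complete, and the composite of [pi]
   and [tau] extends to [A']. *)
pose iC r := tau (pi (iota r)).
have iCP : alg_struct iC.
  case: iotaP => -[i1 [iD iM]] _; split=> [|r a]; last exact: mulrC.
  rewrite /iC; split; first by rewrite i1 pi1.
  by split=> a b; rewrite ?iD ?iM ?piD ?piM ?tauD ?tauM.
have iC0 r : m r -> iC r = 0.
  move=> mr; rewrite /iC (_ : pi (iota r) = 0) ?(additive_map0 tauD) //.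
  by apply/pi_ker/fil1E => //; rewrite -[iota r]mulr1; apply: fil_act; apply/ideal_pow1.
have complC : madic_complete (fun r (x : C') => iC r * x) m.
  by apply: torsion_complete => //; [exact: algebra_action | move=> r x /iC0 ->; rewrite mul0r].
have taupi : alg_hom iota iC (fun a => tau (pi a)).
  split; last by move=> r a; rewrite piM tauM.
  by split; [rewrite pi1 | split=> a b; rewrite ?piD ?piM ?tauD ?tauM].
have [|pi' [[[p1 [pD pM]] pR] pE]] := hom_extend loc taupi complC.
  by exists u; rewrite sc [u * _]mulrC cu.
have [t [gst tgs dense]] := loc_inverse loc.
have [g1 [gD gM]] := loc_hom loc.
have tX k : g (s ^+ k) * t ^+ k = 1.
  elim: k => [|k IH]; first by rewrite g1 mul1r.
  by rewrite exprSr gM exprS mulrA -[g _ * g s * t]mulrA gst mulr1.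
have pt k : tau c ^+ k * pi' (t ^+ k) = 1.
  have tauX : tau (c ^+ k) = tau c ^+ k by elim: k => // k IH; rewrite !exprS tauM IH.
  have piX : pi (s ^+ k) = c ^+ k by elim: k {tauX} => // k IH; rewrite !exprS piM IH sc.
  by rewrite -tauX -piX pE -pM tX.
exists s, A', g, pi'; split=> //.
- by exists u; rewrite sc.
- split; first exact: loc_alg loc.
  split; first exact: loc_isflat loc.
  split; first exact: loc_iscomplete loc.
  split=> //; split; first by move=> k; rewrite -pE piK tauK.
  split=> [y|x].
    have [c' [n yn]] := frac y; have [a ac] := pi_surj c'.
    by exists (g a * t ^+ n); rewrite pM -pE ac -yn -mulrA pt mulr1.
  have alg' := algebra_action (loc_alg loc).
  split=> [px|]; last first.
    move/(fil1E _ _ idm); move: x; apply: fil_ind => [|r x /(ideal_pow1 idm) mr].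
      by split=> [|x y px py]; rewrite ?(additive_map0 pD) // pD px py addr0.
    by rewrite pR iC0 // mul0r.
  (* Modulo [m A'], [x] is a fraction [g a * t^k]. If [pi' x = 0] then [tau (pi a) = 0], so some
     [c^n] kills [pi a]; hence [a s^n] lies in [m A], and the fraction, rewritten as
     [g (a s^n) * t^(n+k)], lies in [m A']. *)
  apply/fil1E => //; have [a [k ak]] := dense x 1.
  have pa : tau (pi a) = 0.
    have : pi' (x - g a * t ^+ k) = 0.
      move: (x - _) ak; apply: fil_ind => [|r z /(ideal_pow1 idm) mr].
        by split=> [|z w pz pw]; rewrite ?(additive_map0 pD) // pD pz pw addr0.
      by rewrite pR iC0 // mul0r.
    rewrite (additive_mapB pD) px sub0r pM -pE => /eqP; rewrite oppr_eq0 => /eqP tk.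
    by rewrite -[LHS]mulr1 -(pt k) mulrCA tk mulr0.
  have [n cn] := tors _ pa.
  rewrite -(subrK (g a * t ^+ k) x); apply: filD => //.
  have -> : g a * t ^+ k = g (a * s ^+ n) * t ^+ (n + k).
    by rewrite gM exprD !mulrA -[g a * _ * _]mulrA tX mulr1.
  apply: (fil_mulr (iota := fun r => g (iota r))).
  have : fil m (fun r (x : A) => iota r * x) 1 (a * s ^+ n).
    apply/fil1E => //; apply/pi_ker; rewrite piM mulrC.
    suff -> : pi (s ^+ n) = c ^+ n by [].
    by elim: (n) => // i IH; rewrite !exprS piM IH sc.
  move: (a * _); apply: fil_ind => [|r z mr]; last by rewrite gM; apply: fil_act.
  split=> [|z w fz fw]; rewrite ?(additive_map0 gD) ?gD; first exact: fil_zero.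
  exact: filD.
Qed.

Lemma deformation_target_unit (K : fieldType) (R : comPzRingType) (kR : K -> R)
    (m : R -> Prop) (C C' C'' : comPzRingType) (kC'' : K -> C'')
    (tau : C -> C') (tau' : C' -> C'') (A A'' : pzRingType) (pi : A -> C)
    (iota'' : R -> A'') (pi'' : A'' -> C'') (h : A -> A'') (s : A) (u : C') :
  ideal m -> ring_hom tau' -> assoc_deformation kR m kC'' iota'' pi'' ->
  lifts pi pi'' (fun c => tau' (tau c)) h -> tau (pi s) * u = 1 ->
  exists v, h s * v = 1 /\ v * h s = 1.
Proof.
move=> idm [t1 [tD tM]] [iP [_ [compl [piP [_ [surj ker]]]]]] hl su.
by apply: (unit_lift idm iP compl (u := tau' u) piP surj ker); rewrite hl -tM su.
Qed.

(** * Derivations and Poisson brackets *)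

Definition derivation_along (A B : comPzRingType) (phi D : A -> B) : Prop :=
  additive_map D /\ (forall x y, D (x * y) = D x * phi y + phi x * D y).

Section DerivationOperations.
Variables (A B : comPzRingType) (phi : A -> B).

Lemma derivationD D E : derivation_along phi D -> derivation_along phi E ->
  derivation_along phi (fun x => D x + E x).
Proof.
move=> [DD DM] [ED EM]; split=> x y; first by rewrite DD ED addrACA.
by rewrite DM EM; ring.
Qed.

Lemma derivationN D : derivation_along phi D -> derivation_along phi (fun x => - D x).
Proof.
move=> [DD DM]; split=> x y; first by rewrite DD opprD.
by rewrite DM; ring.
Qed.

Lemma derivationZ u D : derivation_along phi D -> derivation_along phi (fun x => u * D x).
Proof.
move=> [DD DM]; split=> x y; first by rewrite DD mulrDr.
by rewrite DM; ring.
Qed.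

Lemma derivation0 : derivation_along phi (fun=> 0).
Proof. by split=> x y; rewrite ?addr0 // mul0r mulr0 addr0. Qed.

Lemma derivation_postcomp D : ring_hom phi -> derivation_along id D ->
  derivation_along phi (fun x => phi (D x)).
Proof.
move=> [_ [phiD phiM]] [DD DM]; split=> x y; first by rewrite DD phiD.
by rewrite DM phiD !phiM.
Qed.

Lemma derivation_precomp D : ring_hom phi -> derivation_along id D ->
  derivation_along phi (fun x => D (phi x)).
Proof.
move=> [_ [phiD phiM]] [DD DM]; split=> x y; first by rewrite phiD DD.
by rewrite phiM DM.
Qed.

End DerivationOperations.

Lemma derivation_commutator (A : comPzRingType) (D E : A -> A) :
  derivation_along id D -> derivation_along id E ->
  derivation_along id (fun x => D (E x) - E (D x)).
Proof.
move=> [DD DM] [ED EM]; split=> x y.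
  by rewrite DD !ED !DD opprD addrACA.
by rewrite EM !DM !ED !DD !DM !EM; ring.
Qed.

Lemma complete_pair (R : comPzRingType) (m : R -> Prop) (P Q : zmodType)
    (actP : R -> P -> P) (actQ : R -> Q -> Q) : module_action actP -> module_action actQ ->
  madic_complete actP m -> madic_complete actQ m ->
  madic_complete (fun r (x : P * Q) => (actP r x.1, actQ r x.2)) m.
Proof.
move=> aP aQ [sepP limP] [sepQ limQ].
pose act r (x : P * Q) := (actP r x.1, actQ r x.2).
have [_ _ PDr _] := aP; have [_ _ QDr _] := aQ.
have filE l (x : (P * Q)%type) : fil m act l x <-> fil m actP l x.1 /\ fil m actQ l x.2.
  split.
    move: x; apply: fil_ind => [|r x mr]; last by split; apply: fil_act.
    split=> [|x y [fx1 fx2] [fy1 fy2]]; first by split; apply: fil_zero.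
    by split; apply: filD.
  case: x => x y /= [fx fy].
  have -> : (x, y) = (x, 0) + (0, y) :> (P * Q)%type.
    by rewrite -[RHS]/(x + 0, 0 + y) addr0 add0r.
  apply: filD.
    move: x fx; apply: fil_ind => [|r x mr].
      split=> [|x x' fx fx']; first exact: fil_zero.
      have -> : (x + x', 0) = (x, 0) + (x', 0) :> (P * Q)%type.
        by rewrite -[RHS]/(x + x', 0 + 0) addr0.
      exact: filD.
    have -> : (actP r x, 0) = act r (x, 0) by rewrite /act /= (additive_map0 (QDr r)).
    exact: fil_act.
  move: y fy; apply: fil_ind => [|r y mr].
    split=> [|y y' fy fy']; first exact: fil_zero.
    have -> : (0, y + y') = (0, y) + (0, y') :> (P * Q)%type.
      by rewrite -[RHS]/(0 + 0, y + y') addr0.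
    exact: filD.
  have -> : (0, actQ r y) = act r (0, y) by rewrite /act /= (additive_map0 (PDr r)).
  exact: fil_act.
split=> [[x y] fxy|xs fxs].
  rewrite [x](sepP x _) 1?[y](sepQ y _) // => i.
  - by have /filE [] := fxy i.
  - by have /filE [] := fxy i.
have [i|x xP] := limP (fun i => (xs i).1); first by have /filE [] := fxs i.
have [i|y yP] := limQ (fun i => (xs i).2); first by have /filE [] := fxs i.
by exists (x, y) => i; apply/filE; split; [exact: xP | exact: yP].
Qed.

Section Derivations.
Variables (R : comPzRingType) (m : R -> Prop) (A : comPzRingType) (iota : R -> A) (s : A).
Variables (A' : comPzRingType) (g : A -> A').
Hypotheses (idm : ideal m) (iotaP : alg_struct iota).
Hypothesis loc : completed_localization m iota s g.

Let g1 : g 1 = 1. Proof. by case: (loc_hom loc). Qed.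
Let gD a b : g (a + b) = g a + g b. Proof. by case: (loc_hom loc) => _ []. Qed.
Let gM a b : g (a * b) = g a * g b. Proof. by case: (loc_hom loc) => _ []. Qed.

Lemma loc_unit_s : exists v, g s * v = 1 /\ v * g s = 1.
Proof. by have [t [gst tgs _]] := loc_inverse loc; exists t. Qed.

(** By the Leibniz rule, a derivation that vanishes on the image of [A] is [A]-linear; as it kills
    1, it agrees with the zero map. *)
Lemma derivation_zero (B : comPzRingType) (iB : R -> B) (phi D : A' -> B) :
  alg_struct iB -> alg_hom (fun r => g (iota r)) iB phi ->
  madic_complete (fun r (x : B) => iB r * x) m ->
  derivation_along phi D -> (forall a, D (g a) = 0) -> forall x, D x = 0.
Proof.
move=> iBP [[p1 [pD pM]] pR] compl [DD DM] Dg.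
have hP : alg_hom iota iB (fun a => phi (g a)).
  split; last by move=> r a; rewrite gM pR.
  by split; [rewrite g1 | split=> a b; rewrite ?gD ?gM ?pD ?pM].
apply: (target_unique loc hP compl _ (f2 := fun=> 0)) => //.
- have [v [gv vg]] := loc_unit_s; exists (phi v).
  by rewrite -!pM gv vg p1.
- by move=> x y; rewrite addr0.
- by move=> a x; rewrite DM Dg mul0r add0r.
- by move=> a x; rewrite mulr0.
- by rewrite -g1 Dg.
Qed.

Lemma derivation_unique (D E : A' -> A') : derivation_along id D -> derivation_along id E ->
  (forall a, D (g a) = E (g a)) -> D =1 E.
Proof.
move=> dD dE DE x; apply/eqP; rewrite -subr_eq0; apply/eqP.
apply: (derivation_zero (loc_alg loc) _ (loc_iscomplete loc)
  (derivationD dD (derivationN dE))) => // a.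
by rewrite DE subrr.
Qed.

(* A derivation D is an algebra-module structure a(u, v) = (a u, a v + D(a) u) on A' x A',
   so the universal property of A' extends it. *)
Lemma derivation_extend (D : A -> A') : derivation_along g D -> (forall r, D (iota r) = 0) ->
  exists D' : A' -> A', derivation_along id D' /\ (forall a, D' (g a) = D a).
Proof.
move=> [DD DM] Diota; have D1 : D 1 = 0.
  by case: iotaP => -[<- _] _.
pose P : zmodType := (A' * A')%type.
pose act a (x : P) : P := (g a * x.1, g a * x.2 + D a * x.1).
have actP : module_action act.
  split=> [[u v]|[u v] a b|a [u v] [u' v']|a b [u v]]; rewrite /act /=.
  - by rewrite g1 D1 !mul1r mul0r addr0.
  - rewrite gD DD -[RHS]/(_ + _, _ + _) /=; congr (_, _); ring.
  - rewrite -[RHS]/(_ + _, _ + _) /=; congr (_, _); ring.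
  - rewrite gM DM; congr (_, _); ring.
have compl : madic_complete (fun r => act (iota r)) m.
  have -> : (fun r => act (iota r)) =
      (fun r (x : P) => (g (iota r) * x.1, g (iota r) * x.2)).
    by apply: funext => r; apply: funext => x; rewrite /act Diota mul0r addr0.
  have algP := algebra_action (loc_alg loc).
  by apply: (complete_pair algP algP); exact: loc_iscomplete loc.
have [t [gst tgs]] := loc_unit_s.
have surj (z : P) : exists x, act s x = z.
  case: z => p q; exists (t * p, t * (q - D s * (t * p))).
  by rewrite /act /= !mulrA gst !mul1r subrK.
have inj (x : P) : act s x = 0 -> x = 0.
  case: x => u v; rewrite /act /= => -[su sv].
  have u0 : u = 0 by rewrite -[u]mul1r -tgs -mulrA su mulr0.
  move: sv; rewrite u0 mulr0 addr0 => sv.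
  by rewrite -[v]mul1r -tgs -mulrA sv mulr0.
have [f [fD fM f1]] := loc_universal loc ((1, 0) : P) actP compl surj.
(* The first component is [A]-linear and sends 1 to 1, so it is the identity; the second will be the
   derivation. *)
have fst_f x : (f x).1 = x.
  move: x; apply: (target_unique loc (loc_alg_hom loc) (loc_iscomplete loc) loc_unit_s
    (f1 := fun x => (f x).1) (f2 := id)) => //.
  - by move=> x y; rewrite fD.
  - by move=> a x; rewrite fM.
  - by rewrite f1.
have snd_g a x : (f (g a * x)).2 = g a * (f x).2 + D a * x by rewrite fM /= fst_f.
exists (fun x => (f x).2); split; last first.
  by move=> a; rewrite -[g a]mulr1 snd_g f1 /= mulr0 add0r mulr1.
split=> [x y|x y]; first by rewrite fD.
rewrite -[RHS]/((x * y, (f x).2 * y + x * (f y).2).2).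
suff -> : f (x * y) = (x * y, (f x).2 * y + x * (f y).2) by [].
move: x; apply: (loc_unique loc (actP := act) (f1 := fun x => f (x * y))
  (f2 := fun x => ((x * y, (f x).2 * y + x * (f y).2) : P))) => //.
- exact: complete_separated.
- by move=> a b; rewrite mulrDl fD.
- move=> a b; rewrite fD -[RHS]/(_ + _, _ + _) /=; congr (_, _); ring.
- by move=> a x; rewrite -mulrA fM.
- move=> a x; rewrite snd_g /act /=; congr (_, _); ring.
rewrite mul1r f1 /= mul0r add0r mul1r -{2}[y]fst_f.
by case: (f y).
Qed.

(** * Extension of the Poisson bracket to the localization *)

Section Bracket.
Variable br : A -> A -> A.
Hypothesis brP : poisson_bracket iota br.

Let brDl x y z : br (x + y) z = br x z + br y z. Proof. by case: brP. Qed.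
Let brDr x y z : br x (y + z) = br x y + br x z. Proof. by case: brP => _ []. Qed.
Let brRr r x y : br x (iota r * y) = iota r * br x y.
Proof. by case: brP => _ [_ [_ []]]. Qed.
Let brxx x : br x x = 0. Proof. by case: brP => _ [_ [_ [_ []]]]. Qed.
Let brJ x y z : br x (br y z) + br y (br z x) + br z (br x y) = 0.
Proof. by case: brP => _ [_ [_ [_ [_ []]]]]. Qed.
Let brMr x y z : br x (y * z) = br x y * z + y * br x z.
Proof. by case: brP => _ [_ [_ [_ [_ []]]]]. Qed.

Lemma bracket_antisym x y : br x y = - br y x.
Proof.
have := brxx (x + y); rewrite brDl !brDr !brxx add0r addr0.
by move/eqP; rewrite addr_eq0 => /eqP.
Qed.

Lemma bracketMl x y z : br (x * y) z = br x z * y + x * br y z.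
Proof. by rewrite bracket_antisym brMr (bracket_antisym z x) (bracket_antisym z y); ring. Qed.

Lemma bracket_scalar x r : br x (iota r) = 0.
Proof.
have br1 : br x 1 = 0.
  by have := brMr x 1 1; rewrite !mulr1 mul1r -{1}[br x 1]addr0 => /addrI /esym.
by rewrite -[iota r]mulr1 brRr br1 mulr0.
Qed.

Definition extends_bracket (br' : A' -> A' -> A') : Prop :=
  [/\ forall x, derivation_along id (br'^~ x), forall x, derivation_along id (br' x)
    & forall a b, br' (g a) (g b) = g (br a b)].

(** One variable at a time: for [a] in [A], the derivation [br a] extends to [D a] on [A']; for
    fixed [x], [D a x] is a derivation in [a] along [g], which extends to [E x]. The Leibniz rule in
    one variable is obtained from uniqueness of derivations in the other. *)
Lemma bracket_extend : exists br', extends_bracket br'.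
Proof.
have /choice [D DP] : forall a, exists D, derivation_along id D /\
    (forall b, D (g b) = g (br a b)).
  move=> a; apply: derivation_extend => [|r].
    by split=> b c; rewrite ?brDr ?brMr ?gD ?gM.
  by rewrite bracket_scalar (additive_map0 gD).
have Dder a : derivation_along id (D a) by case: (DP a).
have Dg a b : D a (g b) = g (br a b) by case: (DP a).
have /choice [E EP] : forall x, exists E, derivation_along id E /\
    (forall a, E (g a) = D a x).
  move=> x; apply: (derivation_extend (D := D^~ x)) => [|r].
    split=> a b; move: x; apply: derivation_unique => //.
    - exact: derivationD.
    - by move=> c; rewrite !Dg brDl gD.
    - apply: derivationD; last exact: derivationZ.
      have -> : (fun x => D a x * g b) = (fun x => g b * D a x).
        by apply: funext => x; rewrite mulrC.
      exact: derivationZ.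
    - by move=> c; rewrite !Dg bracketMl gD !gM.
  apply: (derivation_unique (Dder _) (derivation0 _)) => a.
  by rewrite Dg bracket_antisym bracket_scalar oppr0 (additive_map0 gD).
exists (fun y x => E x y); split=> [x|y|a b].
- by case: (EP x).
- have Eder x : derivation_along id (E x) by case: (EP x).
  have Eg x a : E x (g a) = D a x by case: (EP x).
  split=> x1 x2; move: y; apply: derivation_unique => //.
  + exact: derivationD.
  + by move=> a; rewrite !Eg; case: (Dder a).
  + apply: derivationD; last exact: derivationZ.
    have -> : (fun y => E x1 y * x2) = (fun y => x2 * E x1 y).
      by apply: funext => x; rewrite mulrC.
    exact: derivationZ.
  + by move=> a; rewrite !Eg; case: (Dder a).
- by case: (EP (g b)) => _ ->; apply: Dg.
Qed.

Variable br' : A' -> A' -> A'.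
Hypothesis br'P : extends_bracket br'.

Let derl x : derivation_along id (br'^~ x). Proof. by case: br'P. Qed.
Let derr x : derivation_along id (br' x). Proof. by case: br'P. Qed.
Let br'g a b : br' (g a) (g b) = g (br a b). Proof. by case: br'P. Qed.

Lemma biderivation_zero (B : comPzRingType) (iB : R -> B) (phi : A' -> B)
    (E : A' -> A' -> B) : alg_struct iB -> alg_hom (fun r => g (iota r)) iB phi ->
  madic_complete (fun r (x : B) => iB r * x) m ->
  (forall y, derivation_along phi (E^~ y)) -> (forall x, derivation_along phi (E x)) ->
  (forall a b, E (g a) (g b) = 0) -> forall x y, E x y = 0.
Proof.
move=> iBP phiP compl El Er Eg x y; move: x.
apply: (derivation_zero iBP phiP compl (El y)) => a; move: y.
exact: (derivation_zero iBP phiP compl (Er (g a))).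
Qed.

Let idP : alg_hom (fun r => g (iota r)) (fun r => g (iota r)) (@id A'). Proof. by []. Qed.

Lemma extension_antisym x y : br' x y = - br' y x.
Proof.
apply/eqP; rewrite -addr_eq0; apply/eqP; move: x y.
apply: (biderivation_zero (loc_alg loc) idP (loc_iscomplete loc)) => [y|x|a b].
- exact: derivationD.
- exact: derivationD.
- by rewrite !br'g bracket_antisym (additive_mapN gD) addNr.
Qed.

(** Antisymmetry alone gives [2 q x = 0], but it also makes [q] additive with
    [q (y z) = y^2 q z + z^2 q y]. Now [q] vanishes on the image of [A] because [br] is alternating,
    on [t] because [0 = q (g s * t) = (g s)^2 q t], hence on all fractions; it respects the
    filtration, so density concludes. *)
Lemma extension_alternating x : br' x x = 0.
Proof.
have [t [gst tgs dense]] := loc_inverse loc.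
pose q x := br' x x.
have qD y z : q (y + z) = q y + q z.
  rewrite /q; case: (derl (y + z)) => -> _; case: (derr y) => -> _; case: (derr z) => -> _.
  by rewrite (extension_antisym z y); ring.
have qM y z : q (y * z) = y * y * q z + z * z * q y.
  rewrite /q; case: (derl (y * z)) => _ ->; case: (derr y) => _ ->; case: (derr z) => _ ->.
  by rewrite (extension_antisym z y); ring.
have qg a : q (g a) = 0 by rewrite /q br'g brxx (additive_map0 gD).
have qt : q t = 0.
  have : q (g s * t) = 0 by rewrite gst -g1 qg.
  rewrite qM qg mulr0 addr0.
  move/(congr1 (fun z => t * t * z)); rewrite mulr0 => <-.
  by rewrite -[LHS]mul1r -[1]mul1r -tgs; ring.
have qtk k : q (t ^+ k) = 0.
  elim: k => [|k IH]; first by rewrite expr0 -g1 qg.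
  by rewrite exprS qM IH qt !mulr0 addr0.
apply: (fil_separated (loc_iscomplete loc)) => l; have [a [k ak]] := dense x l.
have algP := algebra_action (loc_alg loc).
rewrite -/(q x) -(subrK (g a * t ^+ k) x) qD [q (g a * _)]qM qg qtk !mulr0 !addr0.
move: (x - _) ak; apply: fil_ind => [|r y mr].
  split=> [|y z fy fz]; first by rewrite (additive_map0 qD); apply: fil_zero.
  by rewrite qD; apply: filD.
by rewrite qM qg mulr0 addr0 -mulrA; apply: fil_act.
Qed.

(** By antisymmetry the Jacobi sum is, in its first variable, a derivation minus a commutator of the
    derivations [br' z] and [br' y]. Cyclic invariance makes it a derivation in every variable, so
    vanishing passes from [A] to [A'] one variable at a time. *)
Lemma extension_jacobi x y z : br' x (br' y z) + br' y (br' z x) + br' z (br' x y) = 0.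
Proof.
pose J x y z := br' x (br' y z) + br' y (br' z x) + br' z (br' x y).
have Jder y' z' : derivation_along id (fun x' => J x' y' z').
  have -> : (fun x' => J x' y' z') =
      (fun x' => br' x' (br' y' z') - (br' z' (br' y' x') - br' y' (br' z' x'))).
    apply: funext => x'; rewrite /J (extension_antisym x' y').
    by rewrite (additive_mapN (proj1 (derr z'))); ring.
  by apply: derivationD => //; apply: derivationN; apply: derivation_commutator.
have Jrot x' y' z' : J x' y' z' = J y' z' x' by rewrite /J; ring.
rewrite -/(J x y z).
have zero D : derivation_along id D -> (forall a, D (g a) = 0) -> forall x, D x = 0.
  exact: (derivation_zero (loc_alg loc) idP (loc_iscomplete loc)).
apply: (zero (fun x => J x y z)) => // a; rewrite Jrot.
apply: (zero (fun y => J y z (g a))) => // b; rewrite Jrot.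
apply: (zero (fun z => J z (g a) (g b))) => // c.
by rewrite /J !br'g -!gD brJ (additive_map0 gD).
Qed.

Lemma extension_poisson : poisson_bracket (fun r => g (iota r)) br'.
Proof.
have scal r y : br' (g (iota r)) y = 0.
  move: y; apply: (derivation_zero (loc_alg loc) idP (loc_iscomplete loc)) => // b.
  by rewrite br'g bracket_antisym bracket_scalar oppr0 (additive_map0 gD).
split; first by move=> x y z; case: (derl z) => ->.
split; first by move=> x; case: (derr x).
split; first by move=> r x y; case: (derl y) => _ ->; rewrite scal mul0r add0r.
split.
  move=> r x y; case: (derr x) => _ ->.
  by rewrite (extension_antisym x (g _)) scal oppr0 mul0r add0r.
split; first exact: extension_alternating.
by split; [exact: extension_jacobi | move=> x; case: (derr x)].
Qed.

End Bracket.

End Derivations.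

(** * Assembly of the Poisson and the associative cases *)

Lemma commutative_structure (A : pzRingType) : (forall x y : A, x * y = y * x) ->
  exists B : comPzRingType, A = B :> pzRingType.
Proof.
case: A => T cT comm.
pose B : comPzRingType := HB.pack_for comPzRingType T cT
  (GRing.PzRing_hasCommutativeMul.Build (GRing.PzRing.Pack cT) comm).
by exists B.
Qed.

Theorem theorem2p9 (K : fieldType) (R : comPzRingType) (kR : K -> R) (m : R -> Prop)
  (hR : parameter_algebra kR m)
  (C : comPzRingType) (kC : K -> C) (hC : alg_struct kC)
  (C' : comPzRingType) (kC' : K -> C') (hC' : alg_struct kC')
  (tau : C -> C') (htau : Kalg_hom kC kC' tau) (hloc : principal_localization tau) :
  (* Poisson case *)
  (forall (A : comPzRingType) (iota : R -> A) (br : A -> A -> A) (pi : A -> C),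
    poisson_deformation kR m kC iota br pi ->
    exists (A' : comPzRingType) (iota' : R -> A') (br' : A' -> A' -> A') (pi' : A' -> C')
           (g : A -> A'),
      poisson_deformation kR m kC' iota' br' pi' /\
      poisson_hom iota iota' br br' g /\ lifts pi pi' tau g /\
      (forall (C'' : comPzRingType) (kC'' : K -> C'') (tau' : C' -> C'')
              (A'' : comPzRingType) (iota'' : R -> A'') (br'' : A'' -> A'' -> A'')
              (pi'' : A'' -> C'') (h : A -> A''),
        alg_struct kC'' -> Kalg_hom kC' kC'' tau' ->
        poisson_deformation kR m kC'' iota'' br'' pi'' ->
        poisson_hom iota iota'' br br'' h -> lifts pi pi'' (fun c => tau' (tau c)) h ->
        exists g' : A' -> A'',
          poisson_hom iota' iota'' br' br'' g' /\ (forall a, h a = g' (g a)) /\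
          (forall g2 : A' -> A'', poisson_hom iota' iota'' br' br'' g2 ->
             (forall a, h a = g2 (g a)) -> forall x, g2 x = g' x))) /\
  (* associative case *)
  (forall (A : pzRingType) (iota : R -> A) (pi : A -> C),
    assoc_deformation kR m kC iota pi ->
    exists (A' : pzRingType) (iota' : R -> A') (pi' : A' -> C') (g : A -> A'),
      assoc_deformation kR m kC' iota' pi' /\
      alg_hom iota iota' g /\ lifts pi pi' tau g /\
      (forall (C'' : comPzRingType) (kC'' : K -> C'') (tau' : C' -> C'')
              (A'' : pzRingType) (iota'' : R -> A'') (pi'' : A'' -> C'') (h : A -> A''),
        alg_struct kC'' -> Kalg_hom kC' kC'' tau' ->
        assoc_deformation kR m kC'' iota'' pi'' ->
        alg_hom iota iota'' h -> lifts pi pi'' (fun c => tau' (tau c)) h ->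
        exists g' : A' -> A'',
          alg_hom iota' iota'' g' /\ (forall a, h a = g' (g a)) /\
          (forall g2 : A' -> A'', alg_hom iota' iota'' g2 ->
             (forall a, h a = g2 (g a)) -> forall x, g2 x = g' x))).
Proof.
have idm := parameter_ideal hR; split.
  move=> A iota br pi [iotaP [brP [flatA [complA [augA brpi]]]]].
  (* Forgetting the bracket gives an associative deformation, whose localization is commutative;
     what remains is the bracket and its compatibilities. *)
  have dA : assoc_deformation kR m kC iota pi by [].
  have [s [A0 [g [pi' [loc [u su] dA' lg]]]]] := deformation_localization hR htau hloc dA.
  have comm : forall x y : A0, x * y = y * x by apply: (loc_commutative loc); apply: mulrC.
  have [A' eA] := commutative_structure comm.
  move: g pi' loc dA' lg; rewrite {}eA {A0 comm} => g pi' loc dA' lg.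
  have [br' br'P] := bracket_extend iotaP loc brP.
  have [_ _ br'g] := br'P; have [derl derr _] := br'P.
  have [algA' [flatA' [complA' augA']]] := dA'.
  exists A', (fun r => g (iota r)), br', pi', g.
  split.
    split=> //; split; first exact: (extension_poisson loc brP br'P).
    split=> //; split=> //; split=> // x y.
    have [piP [piK [_ ker]]] := augA'.
    have [pi1 [piD piM]] := piP.
    have iCP : alg_struct (fun r => pi' (g (iota r))).
      case: algA' => -[i1 [iD iM]] _; split=> [|r a]; last exact: mulrC.
      by split; [rewrite i1 | split=> a b; rewrite ?iD ?iM ?piD ?piM].
    have piA : alg_hom (fun r => g (iota r)) (fun r => pi' (g (iota r))) pi' by [].
    have complC : madic_complete (fun r (z : C') => pi' (g (iota r)) * z) m.
      apply: torsion_complete => //; first exact: algebra_action.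
      move=> r z mr; rewrite (_ : pi' _ = 0) ?mul0r //; apply/ker/fil1E => //.
      by rewrite -[g _]mulr1; apply: fil_act; apply/ideal_pow1.
    (* [pi' (br' x y)] is a biderivation along [pi'] into the complete algebra [C']; on the image of
       [A] it is [tau (pi (br a b))], which is 0. *)
    move: x y; apply: (biderivation_zero loc iCP piA complC) => [y|x|a b].
    - exact: derivation_postcomp.
    - exact: derivation_postcomp.
    - by rewrite br'g lg brpi; case: htau => -[_ [tauD _]] _; apply: (additive_map0 tauD).
  split; first by split=> //; exact: (loc_alg_hom loc).
  split=> // C'' kC'' tau' A'' iota'' br'' pi'' h hC'' [tau'P tau'K]
    [iota''P [br''P [flat'' [compl'' [aug'' br''pi]]]]] [hP hbr] lh.
  have dA'' : assoc_deformation kR m kC'' iota'' pi'' by [].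
  have unit_hs := deformation_target_unit idm tau'P dA'' lh su.
  have [g' [g'P hg']] := hom_extend loc hP compl'' unit_hs.
  exists g'; split; last split=> // g2 [[g2P _] _] hg2 x.
    (* The difference [g' (br' x y) - br'' (g' x) (g' y)] is a biderivation along [g'], zero on the
       image of [A] since [h] is Poisson. *)
    split=> // x y; apply/eqP; rewrite -subr_eq0; apply/eqP; move: x y.
    have [brDl [brDr _]] := br''P.
    have [g'hom _] := g'P.
    have der2 z : derivation_along id (br'' z).
      by split; [exact: brDr | case: br''P => _ [_ [_ [_ [_ [_ ]]]]]].
    have der1 z : derivation_along id (br''^~ z).
      by split=> a b; [exact: brDl | exact: (bracketMl br''P)].
    apply: (biderivation_zero loc iota''P g'P compl'') => [y|x|a b].
    - apply: derivationD; first exact: derivation_postcomp.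
      by apply: derivationN; apply: (derivation_precomp g'hom (der1 (g' y))).
    - apply: derivationD; first exact: derivation_postcomp.
      by apply: derivationN; apply: (derivation_precomp g'hom (der2 (g' x))).
    - by rewrite br'g -!hg' hbr subrr.
  by case: g'P => g'hom _; apply: (hom_unique loc hP compl'' unit_hs g2P g'hom).
move=> A iota pi dA; have [iotaP _] := dA.
have [s [A' [g [pi' [loc [u su] dA' lg]]]]] := deformation_localization hR htau hloc dA.
exists A', (fun r => g (iota r)), pi', g; split=> //.
split; first exact: (loc_alg_hom loc).
split=> // C'' kC'' tau' A'' iota'' pi'' h hC'' [tau'P _] dA'' hP lh.
have [_ [_ [compl'' _]]] := dA''.
have unit_hs := deformation_target_unit idm tau'P dA'' lh su.
have [g' [g'P hg']] := hom_extend loc hP compl'' unit_hs.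
exists g'; split=> //; split=> // g2 [g2P _] hg2.
by case: g'P => g'hom _; apply: (hom_unique loc hP compl'' unit_hs g2P g'hom).
Qed.
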